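(* Let $D\subset\mathbb{R}^d$, $d\in\{1,2,3\}$, be a bounded set with smooth boundary and outward unit normal $\nu$, let $\beta>0$, $\kappa>0$, and let $W_t=W(\cdot,t)$ be a $Q$-Wiener process in $L^2(D)$ as described in the context. Then the weak solution $z_t$ of the problem $$dz_t=\Big(\Delta z_t-\frac{\lambda}{z_t^{2}}\Big)dt-\kappa z_t\,dW_t\quad\text{in } D,\ t>0,\qquad \frac{\partial z_t}{\partial\nu}+\beta z_t=0\quad\text{on }\partial D,\ t>0,\qquad 0<z_0=\xi\le 1\ \text{ a.s.},$$ quenches in finite time with probability one, i.e. almost surely, regardless of the size of its initial condition $\xi$ and of the size of the parameter $\lambda>0$.
   Context: Let $H=L^2(D)$ with inner product $(\cdot,\cdot)$, and let $(\Omega,(\mathcal{F}_t),\mathbb{P})$ be a complete filtered probability space. Let $Q$ be a linear, symmetric, non-negative definite trace class operator on $H$ with an orthonormal basis of eigenfunctions $\chi_j\in H$ and eigenvalues $\gamma_j\ge 0$, $\sum_j\gamma_j<\infty$. The $Q$-Wiener process is $W(x,t)=\sum_{j\ge1}\gamma_j^{1/2}\chi_j(x)\beta_j(t)$, where the $\beta_j$ are independent identically distributed $\mathcal{F}_t$-Brownian motions and the series converges in $L^2(\Omega,H)$. A weak solution of the problem is a predictable $H$-valued process $z_t$, positive before the quenching time $\tau$, such that for smooth enough test functions $\varphi$ and $0\le t<\tau$, $\mathbb{P}$-a.s., $$(z_t,\varphi)=(z_0,\varphi)+\int_0^t\!\int_{\partial D}\Big[\frac{\partial z_s}{\partial\nu}\varphi-z_s\frac{\partial\varphi}{\partial\nu}\Big]d\sigma\,ds+\int_0^t(z_s,\Delta\varphi)\,ds-\lambda\int_0^t(z_s^{-2},\varphi)\,ds-\kappa\int_0^t(z_s\,dW_s,\varphi),$$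 where $\partial z_s/\partial\nu=-\beta z_s$ on $\partial D$ by the boundary condition. The quenching time $\tau$ is the (random) stopping time for which $\limsup_{t\to\tau}\inf_{x\in D}|z_t(x)|=0$ a.s. on $\{\tau<+\infty\}$; ''quenches in finite time with probability one'' means $\mathbb{P}[\tau<+\infty]=1$. *)

(* Defs.v *)
From HB Require Import structures.
From mathcomp Require Import all_boot all_order all_algebra.
From mathcomp Require Import all_classical all_reals all_analysis ess_sup_inf.

Set Implicit Arguments.
Unset Strict Implicit.
Unset Printing Implicit Defensive.
Import Order.TTheory GRing.Theory Num.Theory.
Import numFieldNormedType.Exports.

Local Open Scope classical_set_scope.
Local Open Scope ring_scope.

Definition rV_display : measure_display.
Proof. exact: (measure_tuple_display (default_measure_display)). Qed.

(* The sigma-algebra generated by the coordinates; for the usual topology it is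
   the Borel sigma-algebra. *)
Section rV_measurable.
Context {R : realType} (n : nat).

Let coor : 'I_n -> 'rV[R]_n -> R := fun i x => x ord0 i.

Let rV_set0 : g_sigma_preimage coor set0.
Proof. exact: sigma_algebra0. Qed.

Let rV_setC A : g_sigma_preimage coor A -> g_sigma_preimage coor (~` A).
Proof. exact: sigma_algebraC. Qed.

Let rV_bigcup (F : (set 'rV[R]_n)^nat) : (forall i, g_sigma_preimage coor (F i)) ->
  g_sigma_preimage coor (\bigcup_i (F i)).
Proof. exact: sigma_algebra_bigcup. Qed.

HB.instance Definition _ := @isMeasurable.Build rV_display
  'rV[R]_n (g_sigma_preimage coor) rV_set0 rV_setC rV_bigcup.

Lemma measurable_coor (i : 'I_n) :
  measurable_fun [set: 'rV[R]_n] (fun x => x ord0 i).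
Proof.
move=> _ Y mY; rewrite setTI; apply: sub_sigma_algebra.
by rewrite /= (bigD1 i)//=; left; exists Y => //; rewrite setTI.
Qed.

Lemma measurable_fun_rV d (T : measurableType d) (f : T -> 'rV[R]_n) :
  (forall i, measurable_fun setT (fun x => f x ord0 i)) ->
  measurable_fun setT f.
Proof.
move=> mf.
have sub : preimage_set_system setT f
    (\big[setU/set0]_(i < n) preimage_set_system setT (coor i) measurable)
    `<=` measurable.
  move=> _ [B + <-].
  elim/big_ind : _ => [//|X Y hX hY [/hX|/hY]//|i _ [C mC <-]].
  by have := mf i measurableT C mC; rewrite !setTI.
by apply: (measurability (\big[setU/set0]_(i < n) preimage_set_system setT (coor i) measurable)).
Qed.

End rV_measurable.

Section lebesgue_rV.
Context {R : realType}.

Definition consrV (n : nat) (x : R * 'rV[R]_n) : 'rV[R]_n.+1 :=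
  \row_(i < n.+1) if unlift ord0 i is Some j then x.2 ord0 j else x.1.

Lemma measurable_consrV n : measurable_fun setT (@consrV n).
Proof.
apply: measurable_fun_rV => i; rewrite /consrV.
under eq_fun do rewrite mxE.
case: unliftP => [j|] _; last exact: measurable_fst.
exact: (measurableT_comp (measurable_coor j) measurable_snd).
Qed.

Section step.
Context (n : nat) (m : {sigma_finite_measure set 'rV[R]_n -> \bar R}).

Definition lebesgue_rVS : set 'rV[R]_n.+1 -> \bar R :=
  pushforward (@lebesgue_measure R \x m)%E (@consrV n).

Let lebesgue_rVS_measure : {measure set 'rV[R]_n.+1 -> \bar R} :=
  measure_function_pushforward__canonical__measure_function_Measure
    (@lebesgue_measure R \x m)%E (@measurable_consrV n).

HB.instance Definition _ := isMeasure.Build _ _ _ lebesgue_rVS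
  (measure0 lebesgue_rVS_measure) (measure_ge0 lebesgue_rVS_measure)
  (@measure_semi_sigma_additive _ _ _ lebesgue_rVS_measure).

Let sigma_finite_lebesgue_rVS : sigma_finite setT lebesgue_rVS.
Proof.
have /sigma_finiteP[F [FT ndF Foo]] := sigma_finiteT (@lebesgue_measure R).
have /sigma_finiteP[G [GT ndG Goo]] := sigma_finiteT m.
have FGT : [set: R * 'rV[R]_n] = \bigcup_k (F k `*` G k).
  rewrite -setXTT FT GT predeqE => -[x y]; split.
    move=> [/= [k _ Fkx] [l _ Gly]]; exists (maxn k l) => //; split.
    - by move: x Fkx; exact/subsetPset/ndF/leq_maxl.
    - by move: y Gly; exact/subsetPset/ndG/leq_maxr.
  by move=> [k _ []/= ? ?]; split; exists k.
pose g (x : 'rV[R]_n.+1) : R * 'rV[R]_n :=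
  (x ord0 ord0, \row_(j < n) x ord0 (lift ord0 j)).
have mg : measurable_fun setT g.
  apply/measurable_fun_pairP; split; first exact: measurable_coor.
  apply: measurable_fun_rV => i /=.
  by under eq_fun do rewrite mxE; exact: measurable_coor.
have gK y : g (consrV y) = y.
  rewrite /g /consrV mxE unlift_none; case: y => a v /=; congr pair.
  by apply/rowP => j; rewrite !mxE liftK.
exists (fun i => g @^-1` (F i `*` G i)).
  by rewrite -preimage_bigcup -FGT preimage_setT.
move=> i; have [mFi Fioo] := Foo i; have [mGi Gioo] := Goo i; split.
  by rewrite -[X in measurable X]setTI; apply: mg => //; exact: measurableX.
rewrite /lebesgue_rVS /pushforward -comp_preimage.
rewrite (_ : g \o _ = id) ?preimage_id; last by apply/funext => y /=; rewrite gK.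
by rewrite product_measure1E// lte_mul_pinfty// ge0_fin_numE.
Qed.

HB.instance Definition _ := Measure_isSigmaFinite.Build _ _ _ lebesgue_rVS
  sigma_finite_lebesgue_rVS.

End step.

Fixpoint lebesgue_rV (n : nat) : {sigma_finite_measure set 'rV[R]_n -> \bar R} :=
  if n is n'.+1 then lebesgue_rVS (lebesgue_rV n')
  else \d_(0 : 'rV[R]_0).

End lebesgue_rV.

Section euclidean.
Context {R : realType} {n : nat}.
Implicit Types u v : 'rV[R]_n.

(* The library norm on 'rV[R]_n is the sup norm; it gives the right topology
   but not Euclidean lengths. *)
Definition dotv u v : R := \sum_(i < n) u ord0 i * v ord0 i.
Definition enorm u : R := Num.sqrt (dotv u u).

Definition ediam (A : set 'rV[R]_n) : R :=
  sup [set enorm (p.1 - p.2) | p in A `*` A].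

End euclidean.

(* Volume of the unit ball of R^s, so that for integer s the Hausdorff measure
   below is normalised as s-dimensional surface area. *)
Fixpoint unit_ball_volume {R : realType} (s : nat) : R :=
  match s with
  | 0%N => 1
  | 1%N => 2
  | s'.+2 => 2 * pi / s'.+2%:R * unit_ball_volume s'
  end.

Section hausdorff.
Context {R : realType} {n : nat}.
Local Open Scope ereal_scope.

(* [mu_ext] asks for a set function on a semiring of sets; with this type every
   set is measurable, so that covers by arbitrary sets are used. *)
Local Notation W := (g_sigma_algebraType [set: set 'rV[R]_n]).

Definition hausdorff_weight (s : nat) (delta : R) (A : set W) : \bar R :=
  if `[< A = set0 >] then 0
  else if `[< forall x y, A x -> A y -> (enorm (x - y) <= delta)%R >]
  then (unit_ball_volume s * (ediam A / 2) ^+ s)%:E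
  else +oo.

Definition hausdorff (s : nat) (A : set 'rV[R]_n) : \bar R :=
  ereal_sup [set mu_ext (hausdorff_weight s delta) A
            | delta in [set delta : R | (0 < delta)%R]].

Let weight0 s delta : hausdorff_weight s delta set0 = 0.
Proof. by rewrite /hausdorff_weight asboolT. Qed.

Let unit_ball_volume_ge0 s : (0 <= unit_ball_volume s :> R)%R.
Proof.
suff : (0 <= unit_ball_volume s :> R)%R /\ (0 <= unit_ball_volume s.+1 :> R)%R
  by case.
elim: s => [|s [IH1 IH2]]; first by split.
by split => //=; rewrite mulr_ge0// divr_ge0// mulr_ge0// pi_ge0.
Qed.

Let weight_ge0 s delta A : 0 <= hausdorff_weight s delta A.
Proof.
rewrite /hausdorff_weight; case: ifPn => // _; case: ifPn => // _.
rewrite lee_fin mulr_ge0// exprn_ge0// divr_ge0//.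
rewrite /ediam; set S := (X in sup X).
have [supS|/sup_out ->//] := pselect (has_sup S).
have [_ [p Ap _]] := supS.1.
by apply: le_trans (ub_le_sup supS.2 (imageP _ Ap)); exact: sqrtr_ge0.
Qed.

Let ext_ge0 s delta A : 0 <= mu_ext (hausdorff_weight s delta) A.
Proof. by apply: mu_ext_ge0 => X; exact: weight_ge0. Qed.

Let hausdorff_ub s delta A : (0 < delta)%R ->
  mu_ext (hausdorff_weight s delta) A <= hausdorff s A.
Proof. by move=> d0; apply: ereal_sup_ubound; exists delta. Qed.

Let hausdorff0 s : hausdorff s set0 = 0.
Proof.
rewrite /hausdorff; apply/eqP; rewrite eq_le; apply/andP; split.
  apply: ge_ereal_sup => _ [delta d0 <-].
  by rewrite mu_ext0// => X; exact: weight_ge0.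
exact: le_trans (ext_ge0 s 1 _) (hausdorff_ub s _ ltr01).
Qed.

Let hausdorff_ge0 s A : 0 <= hausdorff s A.
Proof. exact: le_trans (ext_ge0 s 1 _) (hausdorff_ub s _ ltr01). Qed.

Let le_hausdorff s : {homo hausdorff s : A B / A `<=` B >-> A <= B}.
Proof.
move=> A B AB; apply: ge_ereal_sup => _ [delta d0 <-].
by apply: le_trans (hausdorff_ub s B d0); exact: le_mu_ext.
Qed.

Let hausdorff_sigma_subadditive s : sigma_subadditive (hausdorff s).
Proof.
move=> A; apply: ge_ereal_sup => _ [delta d0 <-].
apply: le_trans (mu_ext_sigma_subadditive (weight_ge0 s delta) A) _.
by apply: lee_nneseries => // k _; exact: hausdorff_ub.
Qed.

HB.instance Definition _ s := isOuterMeasure.Build R 'rV[R]_n (hausdorff s)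
  (hausdorff0 s) (hausdorff_ge0 s) (@le_hausdorff s)
  (@hausdorff_sigma_subadditive s).

Let hausdorff_measurableType : measurableType _ :=
  caratheodory_type (hausdorff n.-1).

(* The (n-1)-dimensional Hausdorff measure, i.e. surface measure, on the
   sigma-algebra of Caratheodory measurable sets *)
Definition surface_measure : set hausdorff_measurableType -> \bar R :=
  hausdorff n.-1.

Let surface_measure0 : surface_measure set0 = 0.
Proof. exact: hausdorff0. Qed.

Let surface_measure_ge0 A : 0 <= surface_measure A.
Proof. exact: hausdorff_ge0. Qed.

Let surface_measure_sigma_additive : semi_sigma_additive surface_measure.
Proof.
by move=> F mF tF mUF; exact: caratheodory_measure_sigma_additive.
Qed.

HB.instance Definition _ := isMeasure.Build _ _ _ surface_measure
  surface_measure0 surface_measure_ge0 surface_measure_sigma_additive.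

End hausdorff.

Section domains.
Context {R : realType} {d : nat}.
Implicit Types (f phi u v : 'rV[R]_d -> R) (D U : set 'rV[R]_d).

Definition partial (i : 'I_d) f : 'rV[R]_d -> R :=
  fun x => 'D_(delta_mx ord0 i) f x.

Definition grad f (x : 'rV[R]_d) : 'rV[R]_d := \row_(i < d) partial i f x.

Definition laplacian f (x : 'rV[R]_d) : R :=
  \sum_(i < d) partial i (partial i f) x.

Fixpoint class_C (k : nat) f : Prop :=
  continuous f /\
  if k is k'.+1 then
    forall i : 'I_d,
      (forall x, derivable f x (delta_mx ord0 i)) /\ class_C k' (partial i f)
  else True.

Definition smooth f := forall k, class_C k f.

Definition boundary D : set 'rV[R]_d := closure D `\` interior D.

Definition local_defining_function D U (rho : 'rV[R]_d -> R) :=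
  [/\ open U, smooth rho,
      forall x, U x -> (D x <-> rho x < 0),
      forall x, U x -> (boundary D x <-> rho x = 0) &
      forall x, U x -> grad rho x != 0].

Record smooth_bounded_domain D : Prop := SmoothBoundedDomain {
  sbd_open : open D;
  sbd_nonempty : D !=set0;
  sbd_bounded : bounded_set D;
  sbd_smooth : forall y, boundary D y ->
    exists U rho, U y /\ local_defining_function D U rho
}.

Definition outward_unit_normal D (nu : 'rV[R]_d -> 'rV[R]_d) :=
  forall y, boundary D y -> exists U rho,
    [/\ U y, local_defining_function D U rho &
        nu y = (enorm (grad rho y))^-1 *: grad rho y].

Section L2.
Variable D : set 'rV[R]_d.

Definition L2 u :=
  measurable_fun D u /\ (\int[lebesgue_rV d]_(x in D) ((u x) ^+ 2)%:E < +oo)%E.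

Definition inner u v : R := \int[lebesgue_rV d]_(x in D) (u x * v x).

Definition L2norm u : R := Num.sqrt (inner u u).

Definition ae_eq_on u v :=
  {ae lebesgue_rV d, forall x, D x -> u x = v x}.

(* L^2(D) is not quotiented by a.e. equality: a set that is open for the L2
   seminorm is a union of classes. *)
Definition L2_open (G : set ('rV[R]_d -> R)) :=
  forall u, L2 u -> G u -> exists2 e : R, 0 < e &
    forall v, L2 v -> L2norm (v \- u) < e -> G v.

(* Borel measurability of an L^2(D)-valued map defined on X, with respect to
   the sigma-algebra G on X *)
Definition L2_measurable (T : Type) (X : set T) (G : set (set T))
    (h : T -> 'rV[R]_d -> R) :=
  (forall p, X p -> L2 (h p)) /\
  (forall O, L2_open O -> G (X `&` h @^-1` O)).

Definition ess_inf_on u : \bar R :=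
  ess_inf (lebesgue_rV d) (fun x => if x \in D then (u x)%:E else +oo%E).

(* g is the trace of u on the boundary of D: the averages of |u - g(y)| over
   D near y vanish, for almost every boundary point y. This agrees with the
   trace operator on W^{1,1}(D), and with restriction for u continuous up to
   the boundary. *)
Definition boundary_trace u (g : 'rV[R]_d -> R) :=
  (@surface_measure R d).-integrable (boundary D) (EFin \o g) /\
  {ae @surface_measure R d, forall y, boundary D y ->
    (fun r : R => (fine (lebesgue_rV d (D `&` ball y r)))^-1 *
       \int[lebesgue_rV d]_(x in D `&` ball y r) `|u x - g y|)
      @ 0^'+ --> (0 : R)}.

Record orthonormal_basis (chi : nat -> 'rV[R]_d -> R) : Prop :=
  OrthonormalBasis {
    onb_L2 : forall j, L2 (chi j);
    onb_orthonormal : forall i j, inner (chi i) (chi j) = (i == j)%:R;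
    onb_total : forall u, L2 u ->
      (fun n => L2norm (fun x =>
         u x - \sum_(j < n) inner u (chi j) * chi j x)) @ \oo --> (0 : R)
  }.

Record covariance_operator (Q : ('rV[R]_d -> R) -> 'rV[R]_d -> R)
    (chi : nat -> 'rV[R]_d -> R) (gamma : nat -> R) : Prop :=
  CovarianceOperator {
    cov_L2 : forall u, L2 u -> L2 (Q u);
    cov_ext : forall u v, L2 u -> L2 v -> ae_eq_on u v -> ae_eq_on (Q u) (Q v);
    cov_linear : forall a u v, L2 u -> L2 v ->
      ae_eq_on (Q (fun x => a * u x + v x)) (fun x => a * Q u x + Q v x);
    cov_sym : forall u v, L2 u -> L2 v -> inner (Q u) v = inner u (Q v);
    cov_ge0 : forall u, L2 u -> 0 <= inner (Q u) u;
    cov_basis : orthonormal_basis chi;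
    cov_eigen : forall j, ae_eq_on (Q (chi j)) (fun x => gamma j * chi j x);
    cov_eigen_ge0 : forall j, 0 <= gamma j;
    cov_trace_class : (\sum_(0 <= j <oo) (gamma j)%:E < +oo)%E
  }.

End L2.
End domains.

Section stochastic.
Context {R : realType} {dO : measure_display} {Omega : measurableType dO}.
Variables (P : probability Omega R) (F : R -> set (set Omega)).

Record complete_filtration : Prop := CompleteFiltration {
  filt_complete : measure_is_complete P;
  filt_sigma_algebra : forall t, 0 <= t -> sigma_algebra setT (F t);
  filt_measurable : forall t, 0 <= t -> F t `<=` measurable;
  filt_mono : forall s t, 0 <= s -> s <= t -> F s `<=` F t;
  filt_null : forall t, 0 <= t -> P.-negligible `<=` F t
}.

Definition stopping_time (tau : Omega -> \bar R) :=
  (forall w, 0 <= tau w)%E /\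
  (forall t : R, 0 <= t -> F t [set w | tau w <= t%:E]%E).

Record brownian_motion (b : R -> Omega -> R) : Prop := BrownianMotion {
  bm_adapted : forall t (B : set R), 0 <= t -> measurable B ->
    F t (b t @^-1` B);
  bm_start : {ae P, forall w, b 0 w = 0};
  bm_continuous : {ae P, forall w,
    {within `[0, +oo[, continuous (fun t => b t w)}};
  bm_increments : forall s t (A : set Omega) (B : set R),
    0 <= s -> s < t -> F s A -> measurable B ->
    P (A `&` [set w | B (b t w - b s w)]) =
    (P A * normal_prob 0 (Num.sqrt (t - s)) B)%E
}.

Definition process_sigma_algebra (b : R -> Omega -> R) : set (set Omega) :=
  <<s [set A | exists t (B : set R),
         [/\ 0 <= t, measurable B & A = b t @^-1` B]] >>.

Definition independent_processes (b : nat -> R -> Omega -> R) :=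
  forall (J : seq nat) (A : nat -> set Omega), uniq J ->
    (forall j, j \in J -> process_sigma_algebra (b j) (A j)) ->
    P (\bigcap_(j in [set` J]) A j) = (\prod_(j <- J) P (A j))%E.

Definition time_omega : set (R * Omega) := [set p | 0 <= p.1].

Definition predictable : set (set (R * Omega)) :=
  <<s time_omega,
    [set X | (exists2 A, F 0 A & X = [set 0] `*` A) \/
             (exists s t A, [/\ 0 <= s, s <= t, F s A & X = `]s, t] `*` A])] >>.

Section wiener.
Context {d : nat}.
Variables (D : set 'rV[R]_d) (Q : ('rV[R]_d -> R) -> 'rV[R]_d -> R).
Implicit Types (W z f : R -> Omega -> 'rV[R]_d -> R).

Record Q_wiener (chi : nat -> 'rV[R]_d -> R) (gamma : nat -> R)
    (b : nat -> R -> Omega -> R) W : Prop := QWiener {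
  qw_brownian : forall j, brownian_motion (b j);
  qw_independent : independent_processes b;
  qw_measurable : forall t, 0 <= t -> L2_measurable D setT (F t) (W t);
  qw_series : forall t, 0 <= t ->
    (fun n => \int[P]_w ((L2norm D (fun x => W t w x -
       \sum_(j < n) Num.sqrt (gamma j) * chi j x * b j t w)) ^+ 2)%:E)%E
      @ \oo --> 0%E
}.

Definition predictable_process z :=
  L2_measurable D time_omega predictable (fun p => z p.1 p.2).

(* The L^2(D)-valued process 1_{]start, stop] x event} vec; a finite sum of
   such terms is an elementary predictable process. *)
Record elementary_term := ElementaryTerm {
  et_start : R;
  et_stop : R;
  et_event : set Omega;
  et_vec : 'rV[R]_d -> R
}.

Definition elementary_wf (S : seq elementary_term) :=
  forall i e, onth S i = Some e ->
    [/\ 0 <= et_start e, et_start e <= et_stop e,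
        F (et_start e) (et_event e) & L2 D (et_vec e)].

Definition elementary_process (S : seq elementary_term) :
    R -> Omega -> 'rV[R]_d -> R :=
  fun t w x => \sum_(e <- S)
    \1_`]et_start e, et_stop e] t * \1_(et_event e) w * et_vec e x.

Definition elementary_integral W (S : seq elementary_term) (T : R) (w : Omega) :=
  \sum_(e <- S) \1_(et_event e) w *
    inner D (et_vec e)
      (W (Num.min (et_stop e) T) w \- W (Num.min (et_start e) T) w).

(* E int_0^T (Q f_s, f_s) ds: the squared norm in the Ito isometry for the
   integral of (f_s, dW_s) *)
Definition ito_energy f (T : R) : \bar R :=
  (\int[P]_w \int[lebesgue_measure]_(s in `[0%R, T])
     (inner D (Q (f s w)) (f s w))%:E)%E.

(* X = int_0^T (f_s, dW_s), as a limit in L^2(Omega) of integrals of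
   elementary processes *)
Definition ito_integral_at W f (T : R) (X : Omega -> R) :=
  measurable_fun setT X /\
  exists S : nat -> seq elementary_term,
    [/\ forall k, elementary_wf (S k),
        (fun k => ito_energy
           (fun s w x => f s w x - elementary_process (S k) s w x) T)
          @ \oo --> 0%E &
        (fun k => \int[P]_w
           ((X w - elementary_integral W (S k) T w) ^+ 2)%:E)%E
          @ \oo --> 0%E].

Definition announces (rho : nat -> Omega -> R) (tau : Omega -> \bar R) :=
  (forall n, stopping_time (fun w => (rho n w)%:E)) /\
  {ae P, forall w,
    [/\ forall m n, (m <= n)%N -> rho m w <= rho n w,
        forall n, ((rho n w)%:E < tau w)%E &
        (fun n => (rho n w)%:E) @ \oo --> tau w]}.

(* I_t = int_0^t (f_s, dW_s) for t < tau, by localization *)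
Definition ito_integral W (tau : Omega -> \bar R) f (I : R -> Omega -> R) :=
  {ae P, forall w, {within [set t | 0 <= t /\ (t%:E < tau w)%E],
    continuous (fun t => I t w)}} /\
  exists rho, announces rho tau /\
    forall n T, 0 <= T ->
      let f_rho s w x := if s <= rho n w then f s w x else 0 in
      (ito_energy f_rho T < +oo)%E /\
      ito_integral_at W f_rho T (fun w => I (Num.min T (rho n w)) w).

Definition mul_test (u phi : 'rV[R]_d -> R) : 'rV[R]_d -> R :=
  fun x => u x * phi x.

(* Weak solution on [0, tau) of
     dz = (Laplacian z - lambda z^-2) dt - kappa z dW  in D,
     dz/dnu + beta z = 0                               on the boundary,
     z_0 = xi,
   with zb_s the boundary values of z_s; the normal derivative of z_s has been
   replaced by - beta zb_s. *)
Record weak_solution (nu : 'rV[R]_d -> 'rV[R]_d) (beta kappa lambda : R) W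
    (xi : Omega -> 'rV[R]_d -> R) z (tau : Omega -> \bar R) : Prop :=
  WeakSolution {
    ws_predictable : predictable_process z;
    ws_lifetime : stopping_time tau;
    ws_lifetime_gt0 : {ae P, forall w, 0 < tau w}%E;
    ws_initial : {ae P, forall w, ae_eq_on D (z 0 w) (xi w)};
    ws_positive : {ae P, forall w, forall t, 0 <= t -> (t%:E < tau w)%E ->
      {ae lebesgue_rV d, forall x, D x -> 0 < z t w x}};
    ws_equation : exists zb : R -> Omega -> 'rV[R]_d -> R,
      {ae P, forall w, {ae lebesgue_measure, forall s : R,
        0 <= s -> (s%:E < tau w)%E -> boundary_trace D (z s w) (zb s w)}} /\
      forall phi, smooth phi ->
        let flux s w := \int[@surface_measure R d]_(y in boundary D)
          (- beta * zb s w y * phi y - zb s w y * dotv (grad phi y) (nu y)) in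
        let diffusion s w := inner D (z s w) (laplacian phi) in
        let reaction s w := inner D (fun x => (z s w x) ^- 2) phi in
        exists I, ito_integral W tau (fun s w => mul_test (z s w) phi) I /\
          {ae P, forall w, forall t, 0 <= t -> (t%:E < tau w)%E ->
            [/\ {ae lebesgue_measure, forall s : R, 0 <= s -> s <= t ->
                  (lebesgue_rV d).-integrable D
                    (fun x => ((z s w x) ^- 2 * phi x)%:E)},
                lebesgue_measure.-integrable `[0, t] (fun s => (flux s w)%:E),
                lebesgue_measure.-integrable `[0, t]
                  (fun s => (diffusion s w)%:E),
                lebesgue_measure.-integrable `[0, t]
                  (fun s => (reaction s w)%:E) &
                inner D (z t w) phi = inner D (z 0 w) phi
                  + \int[lebesgue_measure]_(s in `[0, t]) flux s w
                  + \int[lebesgue_measure]_(s in `[0, t]) diffusion s w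
                  - lambda * \int[lebesgue_measure]_(s in `[0, t]) reaction s w
                  - kappa * I t w]}
  }.

Definition quenching_time z (tau : Omega -> \bar R) :=
  {ae P, forall w, (tau w < +oo)%E ->
    limf_esup (fun t => ess_inf_on D (fun x => `|z t w x|))
      (fine (tau w))^'- = 0%E}.

Definition quenches_in_finite_time_as (tau : Omega -> \bar R) :=
  P [set w | (tau w < +oo)%E] = 1%E.

End wiener.
End stochastic.

(* Main.v *)
(* Test the equation with the constant 1. The boundary values of a positive
   function are nonnegative, so the Robin flux only removes mass, and
   A_t = (z_t, 1) satisfies, with M the stopped stochastic integral,
     0 <= A_t  and  A_t + lambda int_0^t (z_s^-2, 1) ds <= |D| - kappa M_t.
   The integral has mean zero, hence E[A_s; s < rho] <= |D| for every stopping
   time rho announcing tau. By convexity x^-2 >= 3 a^-2 - 2 a^-3 x, so on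
   G = {T < rho}
     3 a^-2 |D| T P(G) <= |D| / lambda + 2 a^-3 |D| T.
   If P(tau = +oo) > 0, then P(G) >= q > 0 for all T and suitable rho, and
   a = 2 / q contradicts this inequality as T grows. *)
Require Import Defs.
From HB Require Import structures.
From mathcomp Require Import all_boot all_order all_algebra.
From mathcomp Require Import all_classical all_reals all_analysis.
From mathcomp Require Import measurable_realfun ring lra.

Set Implicit Arguments.
Unset Strict Implicit.
Unset Printing Implicit Defensive.

Import Order.TTheory GRing.Theory Num.Theory.
Import numFieldNormedType.Exports.

Local Open Scope classical_set_scope.
Local Open Scope ring_scope.

(** The mean-zero property needs no conditional expectation. Independence of increments is stated
    through the joint law of an event of [F s] and a later increment, so an increment cut to that
    event has a law symmetric about 0. L^2 limits then carry mean zero from the Brownian motions to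
    [W], to elementary integrals and to the stopped Ito integral.

    Restricting to G = {T < rho} is delicate, because G is not known at a time s < T and the
    restricted stochastic integral need not have mean zero. The inequality 1_G A_s <= |D| - kappa
    M_s is therefore used on all of Omega. On G it is the mass bound at time s. Off G its right side
    dominates the mass at time min(s, rho), which is nonnegative. This is where stopping enters.

    The other obstacle is measurability: nothing is known about the boundary values jointly in time
    and space, so the sign of the flux is obtained from integrals defined as suprema over simple
    functions. *)

(** * Order properties of integrals of possibly non-measurable functions *)

Section lower_integral.
Context d (T : measurableType d) (R : realType).
Variable mu : {measure set T -> \bar R}.
Local Open Scope ereal_scope.
Import HBNNSimple.

(** For nonnegative functions the integral is a supremum over simple functions below the integrand,
    and a larger integrand admits more of them. *)
Lemma le_integral_nonmeasurable (D : set T) (f g : T -> \bar R) :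
  (forall x, D x -> 0 <= f x) -> (forall x, D x -> f x <= g x) ->
  \int[mu]_(x in D) f x <= \int[mu]_(x in D) g x.
Proof.
move=> f0 fg; rewrite !ge0_integralE//; last first.
  by move=> x Dx; rewrite (le_trans (f0 _ Dx))// fg.
apply: le_ereal_sup => _ [h hf <-]; exists h => // x.
apply: le_trans (hf x) _; rewrite !patchE; case: ifPn => // /[!inE].
exact: fg.
Qed.

(* Only simple functions below [f] matter, so neither [D] nor [f] has to be
   measurable; this avoids proving that the boundary of a domain is
   Caratheodory measurable for the Hausdorff measure. *)
Lemma integral_funepos_ae_le0 (D : set T) (f : T -> \bar R) :
  {ae mu, forall x, D x -> f x <= 0} -> \int[mu]_(x in D) f^\+ x = 0.
Proof.
move=> aef; apply/eqP; rewrite eq_le; apply/andP; split; last first.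
  by apply: integral_ge0 => *; exact: funepos_ge0.
rewrite ge0_integralE; last by move=> *; exact: funepos_ge0.
apply: ge_ereal_sup => _ [h hf <-].
rewrite -integralT_nnsfun (ae_eq_integral (cst 0)) ?integral0//.
  exact/measurable_EFinP.
apply: filterS aef => x fx _.
apply/eqP; rewrite eq_le; apply/andP; split; last by rewrite lee_fin fun_ge0.
apply: le_trans (hf x) _; rewrite patchE; case: ifPn => // /[!inE] /fx fx0.
by rewrite funeposE ge_max fx0 lexx.
Qed.

(** Only the negative part contributes. If its integral is infinite, [fine] returns 0, which keeps
    the sign. *)
Lemma Rintegral_ae_le0 (D : set T) (f : T -> R) :
  {ae mu, forall x, D x -> (f x <= 0)%R} -> (\int[mu]_(x in D) f x <= 0)%R.
Proof.
move=> aef; rewrite /Rintegral integralE integral_funepos_ae_le0.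
  by rewrite add0e fineN oppr_le0 fine_ge0// integral_ge0// => *;
    exact: funeneg_ge0.
by apply: filterS aef => x fx /fx; rewrite lee_fin.
Qed.

Lemma Rintegral_ae_ge0 (D : set T) (f : T -> R) :
  {ae mu, forall x, D x -> (0 <= f x)%R} -> (0 <= \int[mu]_(x in D) f x)%R.
Proof.
move=> aef; rewrite /Rintegral integralE -funeposN (@integral_funepos_ae_le0 D (\- (EFin \o f))).
  by rewrite sube0 fine_ge0// integral_ge0// => *; exact: funepos_ge0.
by apply: filterS aef => x fx /fx; rewrite -EFinN lee_fin oppr_le0.
Qed.

End lower_integral.

(** * Gaussian laws: first absolute moment and symmetry *)

Section normal_moment.
Variable R : realType.
Local Notation mu := (@lebesgue_measure R).

(** The Radon-Nikodym derivative of the normal law and the explicit density have the same integral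
    over every measurable set, so they agree almost everywhere. *)
Lemma ge0_integral_normal_prob (m s : R) (f : R -> \bar R) :
  (forall x, 0 <= f x)%E -> measurable_fun setT f ->
  (\int[normal_prob m s]_x f x = \int[mu]_x (f x * (normal_pdf m s x)%:E))%E.
Proof.
move=> f0 mf; have dom := normal_prob_dominates m s.
rewrite -(Radon_Nikodym_SigmaFinite.change_of_variables dom)//.
have mpdf : measurable_fun setT (fun x => (normal_pdf m s x)%:E).
  by apply/measurable_EFinP; exact: measurable_normal_pdf.
have iRN := Radon_Nikodym_SigmaFinite.f_integrable dom.
apply: ae_eq_integral => //.
- by apply: emeasurable_funM => //; exact: measurable_int iRN.
- exact: emeasurable_funM.
- apply: ae_eqe_mul2l; apply: integral_ae_eq => // A _ mA.
  by rewrite -Radon_Nikodym_SigmaFinite.f_integral.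
Qed.

(** Doubling the standard deviation absorbs the factor |x|: the integrand is dominated by a multiple
    of the density with parameter 2s, which has integral 1. *)
Lemma normal_abs_moment (s : R) : s != 0 ->
  (\int[normal_prob 0 s]_x `|x|%:E < +oo)%E.
Proof.
move=> s0.
have s2 : 0 < s ^+ 2 by rewrite exprn_even_gt0.
have ds0 : s *+ 2 != 0 by rewrite mulrn_eq0.
have pk0 := normal_peak_gt0 s0; have dpk0 := normal_peak_gt0 ds0.
rewrite ge0_integral_normal_prob//; last first.
  by apply/measurable_EFinP; exact: normr_measurable.
pose C := (1 + 8 / 3 * s ^+ 2) * normal_peak s / normal_peak (s *+ 2).
have bound (x : R) : `|x| * normal_pdf 0 s x <= C * normal_pdf 0 (s *+ 2) x.
  rewrite !normal_pdfE// /normal_fun !subr0.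
  set E1 := expR _; set E2 := expR _.
  (* The exponents are x^2 / (2 s^2) and x^2 / (8 s^2); [y] is their difference. Then |x| <= 1 + x^2
     is at most a constant times 1 + y, hence times exp y. *)
  pose y := x ^+ 2 * (3 / 8) / s ^+ 2.
  have -> : E1 = E2 * expR (- y).
    by rewrite -expRD; congr expR; rewrite /y; field.
  have E20 : 0 < E2 by exact: expR_gt0.
  have -> : C * (normal_peak (s *+ 2) * E2) =
      (1 + 8 / 3 * s ^+ 2) * (normal_peak s * E2).
    by rewrite /C; field; rewrite gt_eqF.
  rewrite [leLHS](_ : _ = normal_peak s * E2 * (`|x| * expR (- y))); last by ring.
  rewrite [leRHS]mulrC ler_pM2l ?mulr_gt0// expRN ler_pdivrMr ?expR_gt0//.
  have y1 := expR_ge1Dx y.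
  have y0 : 0 <= y.
    by apply: divr_ge0; [apply: mulr_ge0; [exact: sqr_ge0|lra]|exact: sqr_ge0].
  have xy : x ^+ 2 = 8 / 3 * s ^+ 2 * y by rewrite /y; field.
  apply: (@le_trans _ _ ((1 + 8 / 3 * s ^+ 2) * (1 + y))); last first.
    by rewrite ler_pM2l//; lra.
  have : `|x| <= 1 + x ^+ 2.
    by rewrite -real_normK ?num_real//; have := sqr_ge0 (`|x| - 1/2); nra.
  by move=> /le_trans; apply; rewrite xy; nra.
apply: (@le_lt_trans _ _ (\int[mu]_x (C%:E * (normal_pdf 0 (s *+ 2) x)%:E)))%E.
  apply: ge0_le_integral => //=.
  - by move=> x _; rewrite -EFinM lee_fin mulr_ge0// normal_pdf_ge0.
  - apply/measurable_EFinP; apply: measurable_funM.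
      exact: normr_measurable.
    exact: measurable_normal_pdf.
  - apply/measurable_EFinP; apply: measurable_funM => //.
    exact: measurable_normal_pdf.
  - by move=> x _; rewrite -!EFinM lee_fin bound.
rewrite integralZl//; last exact: integrable_normal_pdf.
by rewrite integral_normal_pdf mule1 ltry.
Qed.

Lemma normal_prob_opp (s : R) (B : set R) : s != 0 -> measurable B ->
  normal_prob 0 s (-%R @^-1` B) = normal_prob 0 s B.
Proof.
move=> s0 mB; rewrite /normal_prob.
have mN : measurable_fun setT (-%R : measurableTypeR R -> measurableTypeR R).
  exact: measurable_funN.
have -> : (\int[mu]_(x in B) (normal_pdf 0 s x)%:E =
    \int[pushforward mu (-%R : _ -> measurableTypeR R)]_(x in B)
      (normal_pdf 0 s x)%:E)%E.
  by apply: eq_measure_integral => A mA _; exact/esym/lebesgue_measureN.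
rewrite ge0_integral_pushforward//=.
- apply: eq_integral => x _ /=.
  by rewrite !normal_pdfE// /normal_fun !subr0 sqrrN.
- by apply/measurable_EFinP/measurable_funTS; exact: measurable_normal_pdf.
- by move=> x _; rewrite lee_fin normal_pdf_ge0.
Qed.

End normal_moment.

(** * Integrable random variables of mean zero *)

Section centered.
Context d (T : measurableType d) (R : realType) (P : probability T R).
Local Open Scope ereal_scope.

Definition centered (X : T -> R) :=
  P.-integrable setT (EFin \o X) /\ \int[P]_w (X w)%:E = 0.

Lemma centered_measurable X : centered X -> measurable_fun setT X.
Proof. by move=> [/measurable_int/measurable_EFinP]. Qed.

Lemma centered0 : centered (cst 0%R).
Proof. by split; [exact: integrable0|rewrite integral0]. Qed.

Lemma centeredD X Y : centered X -> centered Y -> centered (X \+ Y)%R.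
Proof.
move=> [iX X0] [iY Y0]; split.
  by apply: eq_integrable (integrableD measurableT iX iY).
under eq_integral do rewrite EFinD.
by rewrite integralD// X0 Y0 adde0.
Qed.

Lemma centeredZ k X : centered X -> centered (fun w => k * X w)%R.
Proof.
move=> [iX X0]; split.
  by apply: eq_integrable (integrableZl measurableT k iX).
under eq_integral do rewrite EFinM.
by rewrite integralZl// X0 mule0.
Qed.

Lemma centered_sum (I : Type) (s : seq I) (X : I -> T -> R) :
  (forall i, centered (X i)) -> centered (fun w => \sum_(i <- s) X i w)%R.
Proof.
move=> cX; elim: s => [|i s ih].
  by under eq_fun do rewrite big_nil; exact: centered0.
under eq_fun do rewrite big_cons.
exact: centeredD.
Qed.

(** X and -X have the same law, so the mean equals its own opposite; being finite, it is 0. *)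
Lemma centered_symmetric (X : T -> R) :
  P.-integrable setT (EFin \o X) ->
  (forall B, measurable B -> P (X @^-1` B) = P (X @^-1` (-%R @^-1` B))) ->
  centered X.
Proof.
move=> iX sym; split=> //.
have mX : measurable_fun setT X by exact/measurable_EFinP/measurable_int/iX.
have mNX : measurable_fun setT (\- X)%R by exact: measurable_funN.
have mE : measurable_fun setT (@EFin R) by exact: EFin_measurable.
have iNX : P.-integrable setT (EFin \o (\- X)%R).
  by apply: eq_integrable (integrableN iX).
have e1 : \int[P]_w (X w)%:E = \int[pushforward P X]_x x%:E.
  by rewrite integral_pushforward.
have e2 : \int[P]_w (- X w)%:E = \int[pushforward P (\- X)%R]_x x%:E.
  by rewrite integral_pushforward.
have : \int[P]_w (X w)%:E = \int[P]_w (- X w)%:E.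
  rewrite e1 e2; apply: eq_measure_integral => A mA _.
  exact: sym.
under [RHS]eq_integral do rewrite EFinN.
rewrite integralN/=; last exact: integrable_add_def.
have := integrable_fin_num measurableT iX; rewrite /comp.
case: (\int[P]_w (X w)%:E) => // r _ [] rN; congr EFin; lra.
Qed.

Lemma le_norm_sqr (e x : R) : (0 < e -> `|x| <= e + e^-1 * x ^+ 2)%R.
Proof.
move=> e0; have [xe|ex] := leP `|x|%R e.
  by rewrite (le_trans xe)// lerDl mulr_ge0// ?invr_ge0 ?sqr_ge0// ltW.
rewrite (@le_trans _ _ (e^-1 * x ^+ 2)%R)//; last by rewrite lerDr ltW.
by rewrite mulrC ler_pdivlMr// -real_normK ?num_real// ler_wpM2l// ltW.
Qed.

(** Convergence in L^2 gives convergence in L^1 through |x| <= e + x^2 / e, which stands in for the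
    Cauchy-Schwarz inequality on a probability space. *)
Lemma cvg_centered (X : T -> R) (E : nat -> T -> R) :
  measurable_fun setT X -> (forall k, centered (E k)) ->
  (fun k => \int[P]_w ((X w - E k w) ^+ 2)%:E) @ \oo --> 0 -> centered X.
Proof.
move=> mX cE XE.
have mE k := centered_measurable (cE k).
have m2 k : measurable_fun setT (fun w => ((X w - E k w) ^+ 2)%:E).
  apply/measurable_EFinP; apply: measurable_funX.
  exact: measurable_funB.
have small (e : R) : (0 < e)%R ->
    exists k, \int[P]_w ((X w - E k w) ^+ 2)%:E < e%:E.
  move=> e0; have : nbhs (0 : \bar R) [set x | x < e%:E].
    by apply: open_ereal_lt'; rewrite lte_fin.
  by move=> /XE [k _ /(_ k (leqnn k)) kl]; exists k.
have bound (e : R) k : (0 < e)%R ->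
    \int[P]_w `|X w - E k w|%:E <=
    e%:E + e^-1%:E * \int[P]_w ((X w - E k w) ^+ 2)%:E.
  move=> e0.
  have -> : e%:E = \int[P]_w (cst e%:E w).
    by rewrite integral_cst//= probability_setT mule1.
  rewrite -ge0_integralZl//; last 2 first.
    by move=> w _; rewrite lee_fin sqr_ge0.
    by rewrite lee_fin invr_ge0 ltW.
  rewrite -ge0_integralD//; last 3 first.
    by move=> w _; rewrite lee_fin ltW.
    by move=> w _; rewrite mule_ge0// lee_fin ?sqr_ge0// invr_ge0 ltW.
    exact: measurable_funeM.
  apply: ge0_le_integral => //.
  - by apply/measurable_EFinP/measurableT_comp => //; exact: measurable_funB.
  - by apply: emeasurable_funD => //; exact: measurable_funeM.
  - by move=> w _; rewrite -EFinM -EFinD lee_fin le_norm_sqr.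
have iX : P.-integrable setT (EFin \o X).
  have [k kl] := small 1%R ltr01.
  have iD : P.-integrable setT (EFin \o (fun w => X w - E k w)%R).
    apply/integrableP; split; first exact/measurable_EFinP/measurable_funB.
    apply: le_lt_trans (bound 1%R k ltr01) _.
    by rewrite invr1 mul1e; apply: lte_add_pinfty; rewrite ?ltry// (lt_le_trans kl) ?leey.
  apply: eq_integrable (integrableD measurableT iD (cE k).1) => // w _ /=.
  by rewrite -EFinD subrK.
split=> //; apply/eqP; rewrite -abse_eq0 eq_le abse_ge0 andbT.
apply/lee_addgt0Pr => e e0; rewrite add0e.
have e20 : (0 < e / 2)%R by rewrite divr_gt0.
(* A second moment below (e/2)^2 makes both terms of [bound], taken at e/2, at most e/2. *)
have [k kl] := small _ (exprn_gt0 2 e20).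
have -> : \int[P]_w (X w)%:E = \int[P]_w (X w - E k w)%:E.
  under [RHS]eq_integral do rewrite EFinB.
  by rewrite integralB// ?(cE k).2 ?sube0//; case: (cE k).
apply: le_trans (le_abse_integral _ _ _) _ => //.
  exact/measurable_EFinP/measurable_funB.
apply: le_trans (bound _ k e20) _.
apply: (@le_trans _ _ ((e / 2)%:E + (e / 2)^-1%:E * ((e / 2) ^+ 2)%:E)).
  apply/leeD2l/lee_wpmul2l; last exact: ltW.
  by rewrite lee_fin invr_ge0 ltW.
by rewrite -EFinM -EFinD lee_fin expr2 mulKf ?gt_eqF//; lra.
Qed.

End centered.

(** * The inner product of L^2(D) and measurability of its linear functionals *)

Section L2_inner.
Context (R : realType) (d : nat) (D : set 'rV[R]_d).
Hypothesis mD : measurable D.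
Local Notation mu := (@lebesgue_rV R d).
Implicit Types u v w : 'rV[R]_d -> R.

Lemma L2_integrableM u v : L2 D u -> L2 D v ->
  mu.-integrable D (EFin \o (fun x => u x * v x)).
Proof.
move=> [mu_ iu] [mv iv]; apply/integrableP; split.
  by apply/measurable_EFinP; exact: measurable_funM.
have m2 (f : _ -> R) : measurable_fun D f -> measurable_fun D (fun x => ((f x) ^+ 2)%:E).
  by move=> mf; apply/measurable_EFinP; exact: measurable_funX.
apply: (@le_lt_trans _ _
    (\int[mu]_(x in D) (((u x) ^+ 2)%:E + ((v x) ^+ 2)%:E))%E); last first.
  rewrite ge0_integralD//.
  - exact: lte_add_pinfty.
  - by move=> x _; rewrite lee_fin sqr_ge0.
  - exact: m2.
  - by move=> x _; rewrite lee_fin sqr_ge0.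
  - exact: m2.
apply: ge0_le_integral => //.
- by apply/measurable_EFinP/measurableT_comp => //; exact: measurable_funM.
- by apply: emeasurable_funD; exact: m2.
- move=> x _; rewrite /= -EFinD lee_fin normrM.
  rewrite -(real_normK (num_real (u x))) -(real_normK (num_real (v x))).
  by have := sqr_ge0 (`|u x| - `|v x|); have := mulr_ge0 (normr_ge0 (u x)) (normr_ge0 (v x)); nra.
Qed.

Lemma integrableM_L2 u : measurable_fun D u ->
  mu.-integrable D (EFin \o (fun x => u x * u x)) -> L2 D u.
Proof.
move=> mu_ /integrableP[_ iu]; split=> //; apply: le_lt_trans iu.
apply: le_integral_nonmeasurable => x _; rewrite ?lee_fin ?sqr_ge0//=.
by rewrite expr2 ler_norm.
Qed.

Lemma L2Z k u : L2 D u -> L2 D (fun x => k * u x).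
Proof.
move=> Lu; apply: integrableM_L2; first exact: measurable_funM Lu.1.
apply: eq_integrable (integrableZl mD (k ^+ 2) (L2_integrableM Lu Lu)) => //.
by move=> x _ /=; rewrite -EFinM; congr EFin; ring.
Qed.

Lemma L2D u v : L2 D u -> L2 D v -> L2 D (fun x => u x + v x).
Proof.
move=> Lu Lv; apply: integrableM_L2.
  exact: measurable_funD Lu.1 Lv.1.
apply: eq_integrable (integrableD mD
  (integrableD mD (L2_integrableM Lu Lu) (L2_integrableM Lv Lv))
  (integrableZl mD 2 (L2_integrableM Lu Lv))) => //.
by move=> x _ /=; rewrite -EFinM -!EFinD; congr EFin; ring.
Qed.

Lemma L2B u v : L2 D u -> L2 D v -> L2 D (fun x => u x - v x).
Proof.
move=> Lu Lv; have := L2D Lu (L2Z (-1) Lv).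
by under eq_fun do rewrite mulN1r.
Qed.

Lemma L2_0 : L2 D (fun=> 0).
Proof.
split; first exact: measurable_cst.
by under eq_integral do rewrite expr0n/=; rewrite integral0 ltry.
Qed.

Lemma L2_sum (I : Type) (s : seq I) (u : I -> 'rV[R]_d -> R) :
  (forall i, L2 D (u i)) -> L2 D (fun x => \sum_(i <- s) u i x).
Proof.
move=> Lu; elim: s => [|i s ih].
  by under eq_fun do rewrite big_nil; exact: L2_0.
by under eq_fun do rewrite big_cons; exact: L2D.
Qed.

Lemma innerC u v : inner D u v = inner D v u.
Proof. by apply: eq_Rintegral => x _; rewrite mulrC. Qed.

Lemma innerZl k u v : L2 D u -> L2 D v ->
  inner D (fun x => k * u x) v = k * inner D u v.
Proof.
move=> Lu Lv; rewrite /inner -RintegralZl//; last exact: L2_integrableM.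
by apply: eq_Rintegral => x _; rewrite mulrA.
Qed.

Lemma innerDl u v w : L2 D u -> L2 D v -> L2 D w ->
  inner D (fun x => u x + v x) w = inner D u w + inner D v w.
Proof.
move=> Lu Lv Lw; rewrite /inner -RintegralD//; try exact: L2_integrableM.
by apply: eq_Rintegral => x _; rewrite mulrDl.
Qed.

Lemma innerBl u v w : L2 D u -> L2 D v -> L2 D w ->
  inner D (fun x => u x - v x) w = inner D u w - inner D v w.
Proof.
move=> Lu Lv Lw; rewrite /inner -RintegralB//; try exact: L2_integrableM.
by apply: eq_Rintegral => x _; rewrite mulrBl.
Qed.

Lemma inner0l v : inner D (fun=> 0) v = 0.
Proof.
rewrite /inner /Rintegral; under eq_integral do rewrite mul0r.
by rewrite integral0.
Qed.

Lemma inner_suml (I : Type) (s : seq I) (u : I -> 'rV[R]_d -> R) v :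
  (forall i, L2 D (u i)) -> L2 D v ->
  inner D (fun x => \sum_(i <- s) u i x) v = \sum_(i <- s) inner D (u i) v.
Proof.
move=> Lu Lv; elim: s => [|i s ih].
  by under eq_fun do rewrite big_nil; rewrite big_nil inner0l.
under eq_fun do rewrite big_cons.
by rewrite innerDl ?big_cons ?ih//; exact: L2_sum.
Qed.

Lemma inner_ge0 u : 0 <= inner D u u.
Proof. by apply: Rintegral_ge0 => x _; rewrite -expr2 sqr_ge0. Qed.

Lemma L2norm_sqr u : L2norm D u ^+ 2 = inner D u u.
Proof. by rewrite sqr_sqrtr// inner_ge0. Qed.

Lemma cauchy_schwarz u v : L2 D u -> L2 D v ->
  inner D u v ^+ 2 <= inner D u u * inner D v v.
Proof.
move=> Lu Lv.
have quad a b : 0 <= a ^+ 2 * inner D u u + b ^+ 2 * inner D v v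
    - 2 * a * b * inner D u v.
  have := inner_ge0 (fun x => a * u x - b * v x).
  have La := L2Z a Lu; have Lb := L2Z b Lv.
  rewrite innerBl//; last exact: L2B.
  rewrite innerC innerBl// [X in _ - X]innerC innerBl//.
  rewrite !innerZl// ![inner D _ (fun x => _ * _)]innerC !innerZl//.
  by rewrite [inner D v u]innerC; nra.
have := inner_ge0 u; have := inner_ge0 v.
set U := inner D u u in quad *; set V := inner D v v in quad *.
set I := inner D u v in quad * => V0 U0.
move: V0; rewrite le_eqVlt => /orP[/eqP V0|V0].
  have [->|I0] := eqVneq I 0; first by rewrite expr0n/= -V0 mulr0.
  (* With V = 0 and I nonzero, this choice turns the quadratic form into U - (U + 1) = -1, a
     contradiction. For V > 0, the choice a = V, b = I below gives V (U V - I^2) >= 0. *)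
  have := quad 1 ((U + 1) / (2 * I)).
  rewrite -V0 mulr0 addr0 expr1n mul1r mulr1.
  by rewrite [2 * _ * _](_ : _ = U + 1); [lra | field].
have := quad V I; nra.
Qed.

(** By Cauchy-Schwarz the functional moves by at most the distance times the norm of [v]. The radius
    divides by 1 + (v, v), which exceeds that norm and stays positive when [v] vanishes almost
    everywhere. *)
Lemma L2_open_inner_gt c v : L2 D v -> L2_open D [set u | c < inner D u v].
Proof.
move=> Lv u Lu /= cu.
pose e := (inner D u v - c) / (1 + inner D v v).
have v1 : 0 < 1 + inner D v v by rewrite ltr_pwDl// inner_ge0.
have e0 : 0 < e by rewrite divr_gt0// subr_gt0.
exists e => // w Lw we.
have -> : inner D w v = inner D u v + inner D (w \- u) v.
  by rewrite [inner D (w \- u) _]innerBl// addrC subrK.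
have Lwu : L2 D (w \- u) by exact: L2B.
have := cauchy_schwarz Lwu Lv; rewrite -L2norm_sqr.
set i := inner D (w \- u) v; set n := L2norm _ _ in we *.
have n0 : 0 <= n by exact: sqrtr_ge0.
have V0 := inner_ge0 v; set V := inner D v v in v1 e V0 e0 we *.
have -> : inner D u v = c + e * (1 + V).
  by rewrite /e divfK ?gt_eqF// addrC subrK.
move=> ile.
have : `|i| < e * (1 + V).
  have ev : 0 <= e * (1 + V) by rewrite ltW// mulr_gt0.
  rewrite -(@ltr_pXn2r _ 2)// ?nnegrE//.
  rewrite real_normK ?num_real//.
  apply: le_lt_trans ile _; rewrite exprMn.
  by apply: ltr_pM => //; rewrite ?sqr_ge0// ?ltr_pXn2r ?nnegrE// ?ltW//; nra.
by move=> /ltr_normlP[? ?]; lra.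
Qed.

(** [L2_measurable] speaks only of preimages of open sets; the rays ]x, +oo[ generate the Borel sets
    of the line and pull back to open half-spaces of L^2(D). *)
Lemma measurable_inner d' (T : measurableType d') (X : set T) (G : set (set T))
    (h : T -> 'rV[R]_d -> R) v :
  measurable X -> G `<=` measurable -> L2_measurable D X G h -> L2 D v ->
  measurable_fun X (fun p => inner D (h p) v).
Proof.
move=> mX Gm [_ hO] Lv.
apply: (measurability _ (RGenOInfty.measurableE R)) => // _ [_ [x ->] <-].
apply: Gm; rewrite [X in G X](_ : _ = X `&` h @^-1` [set u | x < inner D u v]).
  exact/hO/L2_open_inner_gt.
by apply/seteqP; split => p [Xp]; rewrite /= in_itv/= andbT.
Qed.

End L2_inner.

(** * Stochastic integrals have mean zero *)

Section wiener_integral.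
Context (R : realType) (dO : measure_display) (Omega : measurableType dO).
Variables (P : probability Omega R) (F : R -> set (set Omega)).
Hypothesis filtF : complete_filtration P F.

Lemma brownian_measurable (b : R -> Omega -> R) t :
  brownian_motion P F b -> 0 <= t -> measurable_fun setT (b t).
Proof.
move=> bm t0 _ B mB; rewrite setTI.
exact: (filt_measurable filtF t0 (bm_adapted bm t0 mB)).
Qed.

Lemma filtration_setT t : 0 <= t -> F t setT.
Proof.
move=> t0; have [F0 FC _] := filt_sigma_algebra filtF t0.
by rewrite -(setD0 setT); exact: FC.
Qed.

(** On [A] the increment has law P(A) times a centered Gaussian; off [A] the product is 0. Both
    parts are invariant under a change of sign. *)
Lemma brownian_increment_centered (b : R -> Omega -> R) (s t : R) A :
  brownian_motion P F b -> 0 <= s -> s < t -> F s A ->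
  centered P (fun w => \1_A w * (b t w - b s w)).
Proof.
move=> bm s0 st FA; have t0 : 0 <= t by rewrite (le_trans s0)// ltW.
have mA : measurable A by exact: (filt_measurable filtF s0).
pose X w := b t w - b s w.
have mX : measurable_fun setT X.
  by apply: measurable_funB; exact: brownian_measurable.
have mY : measurable_fun setT (fun w => \1_A w * X w).
  by apply: measurable_funM => //; exact: measurable_indic.
have sg0 : Num.sqrt (t - s) != 0 by rewrite sqrtr_eq0 -ltNge subr_gt0.
have iX : P.-integrable setT (EFin \o X).
  apply/integrableP; split; first exact/measurable_EFinP.
  apply: le_lt_trans (normal_abs_moment sg0).
  pose X' : Omega -> measurableTypeR R := X.
  rewrite (_ : (\int[P]_x _)%E = \int[pushforward P X']_x `|x|%:E)%E; last first.
    rewrite ge0_integral_pushforward//.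
    by apply/measurable_EFinP; exact: normr_measurable.
  rewrite le_eqVlt; apply/orP; left; apply/eqP.
  apply: eq_measure_integral => B mB _.
  have := bm_increments bm s0 st (filtration_setT s0) mB.
  by rewrite setTI probability_setT mul1e.
apply: centered_symmetric.
  apply: le_integrable iX => //; first exact/measurable_EFinP.
  move=> w _; rewrite /= lee_fin normrM ler_piMl//.
  by rewrite indicE; case: (_ \in _); rewrite ?normr1 ?normr0.
have law (B : set R) : measurable B -> P (A `&` X @^-1` (-%R @^-1` B)) =
    P (A `&` X @^-1` B).
  move=> mB.
  have mNB : measurable (-%R @^-1` B).
    by rewrite -[X in measurable X]setTI; exact: measurable_funN.
  have /= -> := bm_increments bm s0 st FA mB.
  by have /= -> := bm_increments bm s0 st FA mNB; rewrite normal_prob_opp.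
have split_law (B : set R) : measurable B -> P ((fun w => \1_A w * X w) @^-1` B) =
    (P (A `&` X @^-1` B) + (if (0 : R)%R \in B then P (~` A) else 0))%E.
  move=> mB.
  have mXB : measurable (A `&` X @^-1` B).
    by apply: measurableI => //; rewrite -[X in measurable X]setTI; exact: mX.
  case: ifPn => [/[!inE] B0|nB0].
    rewrite -measureU//; last 2 first.
      exact: measurableC.
      by rewrite -subset0 => w [[? _]].
    congr (P _); apply/seteqP; split => w /=.
      have [wA|wA] := pselect (A w); last by right.
      by rewrite indicE mem_set// mul1r; left.
    move=> [[wA]|wA]; first by rewrite indicE mem_set// mul1r.
    by rewrite indicE memNset// mul0r.
  rewrite adde0; congr (P _); apply/seteqP; split => w /=.
    have [wA|wA] := pselect (A w); first by rewrite indicE mem_set// mul1r.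
    by rewrite indicE memNset// mul0r => B0; rewrite mem_set in nB0.
  by move=> [wA]; rewrite indicE mem_set// mul1r.
move=> B mB; rewrite !split_law//; last first.
  by rewrite -[X in measurable X]setTI; exact: measurable_funN.
rewrite law//; congr (_ + _)%E; congr (if _ then _ else _).
by apply/idP/idP => /set_mem/= B0; apply/mem_set; rewrite /= oppr0 in B0 *.
Qed.

Context (d : nat) (D : set 'rV[R]_d).
Hypothesis mD : measurable D.
Variables (Q : ('rV[R]_d -> R) -> 'rV[R]_d -> R).
Variables (chi : nat -> 'rV[R]_d -> R) (gamma : nat -> R).
Hypothesis covQ : covariance_operator D Q chi gamma.
Variables (b : nat -> R -> Omega -> R) (W : R -> Omega -> 'rV[R]_d -> R).
Hypothesis wW : Q_wiener P F D chi gamma b W.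

Let chiL2 j : L2 D (chi j). Proof. exact: onb_L2 (cov_basis covQ) j. Qed.

Let WL2 t w : 0 <= t -> L2 D (W t w).
Proof. by move=> t0; have [+ _] := qw_measurable wW t0; exact. Qed.

Lemma measurable_inner_wiener t v : 0 <= t -> L2 D v ->
  measurable_fun setT (fun w => inner D (W t w) v).
Proof.
move=> t0; apply: (measurable_inner mD measurableT _ (qw_measurable wW t0)).
exact: (filt_measurable filtF).
Qed.

(** Pairing with [v] is continuous on L^2(D), so the series for [W] becomes a scalar series of
    Brownian motions converging in L^2(Omega). *)
Lemma inner_wiener_series t v : 0 <= t -> L2 D v ->
  (fun n => \int[P]_w ((inner D (W t w) v -
     \sum_(j < n) Num.sqrt (gamma j) * inner D (chi j) v * b j t w) ^+ 2)%:E)%E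
    @ \oo --> 0%E.
Proof.
move=> t0 Lv; pose S n w x := \sum_(j < n) Num.sqrt (gamma j) * chi j x * b j t w.
have SE n w x : S n w x = \sum_(j < n) (Num.sqrt (gamma j) * b j t w) * chi j x.
  by apply: eq_bigr => j _; rewrite mulrAC.
have LS n w : L2 D (S n w).
  rewrite (funext (SE n w)).
  by apply: L2_sum => // j; exact: L2Z.
have eqS n w : inner D (W t w) v -
    \sum_(j < n) Num.sqrt (gamma j) * inner D (chi j) v * b j t w =
    inner D (fun x => W t w x - S n w x) v.
  rewrite innerBl//; last exact: WL2.
  congr (_ - _); rewrite (funext (SE n w)).
  rewrite inner_suml//; last by move=> j; exact: L2Z.
  by apply: eq_bigr => j _; rewrite innerZl// mulrAC.
pose c := 1 + inner D v v; have c0 : 0 < c by rewrite ltr_pwDl// inner_ge0.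
have lim0 : (fun n => c%:E * \int[P]_w ((L2norm D (fun x => W t w x - S n w x)) ^+ 2)%:E)%E
    @ \oo --> 0%E.
  by rewrite -[X in _ --> X](mule0 c%:E); apply: cvgeZl => //; exact: (qw_series wW t0).
apply: (squeeze_cvge _ (cvg_cst _) lim0); near=> n; apply/andP; split.
  by apply: integral_ge0 => w _; rewrite lee_fin sqr_ge0.
pose f w := inner D (W t w) v -
  \sum_(j < n) Num.sqrt (gamma j) * inner D (chi j) v * b j t w.
have mf : measurable_fun setT f.
  apply: measurable_funB; first exact: measurable_inner_wiener.
  apply: measurable_sum => j; apply: measurable_funM => //.
  exact: brownian_measurable (qw_brownian wW j) t0.
(* The factor is pulled out of the integral of [f], known to be measurable, rather than out of that
   of the L^2 norm. The 1 added in [c] makes it invertible. *)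
rewrite [leLHS](_ : _ = c%:E * \int[P]_w (c^-1 * f w ^+ 2)%:E)%E; last first.
  rewrite -ge0_integralZl//; last 3 first.
  - apply/measurable_EFinP; apply: measurable_funM => //.
    exact: measurable_funX.
  - by move=> w _; rewrite lee_fin mulr_ge0 ?sqr_ge0// invr_ge0 ltW.
  - by rewrite lee_fin ltW.
  by apply: eq_integral => w _; rewrite -EFinM mulVKf ?gt_eqF.
apply: lee_wpmul2l; first by rewrite lee_fin ltW.
apply: le_integral_nonmeasurable => w _.
  by rewrite lee_fin mulr_ge0 ?sqr_ge0// invr_ge0 ltW.
rewrite lee_fin ler_pdivrMl// /f eqS.
have LWS : L2 D (fun x => W t w x - S n w x) by apply: L2B => //; exact: WL2.
rewrite L2norm_sqr (le_trans (cauchy_schwarz mD LWS Lv))// mulrC.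
by rewrite ler_wpM2r ?inner_ge0// /c lerDr.
Unshelve. all: by end_near. Qed.

(** An L^2 limit of finite sums of Brownian increments cut to [A]. The errors at times s and t
    combine by (x - y)^2 <= 2 (x^2 + y^2), and the indicator only decreases a square. *)
Lemma wiener_increment_centered s t A v : 0 <= s -> s <= t -> F s A -> L2 D v ->
  centered P (fun w => \1_A w * inner D v (W t w \- W s w)).
Proof.
move=> s0; rewrite le_eqVlt => /predU1P[<- FA Lv|st FA Lv].
  rewrite (_ : (fun _ => _) = cst 0); first exact: centered0.
  apply/funext => w; rewrite innerC (_ : _ \- _ = fun=> 0) ?inner0l ?mulr0//.
  by apply/funext => x; rewrite /= subrr.
have t0 : 0 <= t by rewrite (le_trans s0)// ltW.
have mA : measurable A by exact: (filt_measurable filtF s0).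
pose coef j := Num.sqrt (gamma j) * inner D (chi j) v.
pose S n r w := \sum_(j < n) coef j * b j r w.
pose X r w := inner D (W r w) v.
have mS n r : 0 <= r -> measurable_fun setT (S n r).
  move=> r0; apply: measurable_sum => j; apply: measurable_funM => //.
  exact: brownian_measurable (qw_brownian wW j) r0.
have mX r : 0 <= r -> measurable_fun setT (X r).
  by move=> r0; exact: measurable_inner_wiener.
have mXS n r : 0 <= r ->
    measurable_fun setT (fun w => ((X r w - S n r w) ^+ 2)%:E).
  move=> r0; apply/measurable_EFinP/measurable_funX.
  by apply: measurable_funB; [exact: mX|exact: mS].
rewrite (_ : (fun _ => _) = (fun w => \1_A w * (X t w - X s w))); last first.
  by apply/funext => w; rewrite innerC innerBl//; exact: WL2.
apply: (@cvg_centered _ _ _ _ _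
    (fun n w => \sum_(j < n) coef j * (\1_A w * (b j t w - b j s w)))).
- apply: measurable_funM; first exact: measurable_indic.
  by apply: measurable_funB; exact: mX.
- move=> n; apply: centered_sum => j; apply: centeredZ.
  exact: brownian_increment_centered (qw_brownian wW j) s0 st FA.
have lim0 : (fun n => 2%:E * (\int[P]_w ((X t w - S n t w) ^+ 2)%:E +
    \int[P]_w ((X s w - S n s w) ^+ 2)%:E))%E @ \oo --> 0%E.
  rewrite -[X in _ --> X](mule0 2%:E); apply: cvgeZl => //.
  rewrite -[X in _ --> X](adde0 0%E).
  by apply: cvgeD => //; exact: inner_wiener_series.
apply: (squeeze_cvge _ (cvg_cst _) lim0); near=> n; apply/andP; split.
  by apply: integral_ge0 => w _; rewrite lee_fin sqr_ge0.
rewrite -ge0_integralD//; [|by move=> w _; rewrite lee_fin sqr_ge0|exact: mXS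
  |by move=> w _; rewrite lee_fin sqr_ge0|exact: mXS].
rewrite -ge0_integralZl//; last first.
- by move=> w _; rewrite -EFinD lee_fin addr_ge0// sqr_ge0.
- by apply: emeasurable_funD; exact: mXS.
apply: le_integral_nonmeasurable => w _; first by rewrite lee_fin sqr_ge0.
rewrite -EFinD -EFinM lee_fin.
have -> : \sum_(j < n) coef j * (\1_A w * (b j t w - b j s w)) =
    \1_A w * (S n t w - S n s w).
  rewrite /S -sumrB mulr_sumr; apply: eq_bigr => j _; ring.
rewrite -mulrBr exprMn.
apply: (@le_trans _ _ ((X t w - X s w - (S n t w - S n s w)) ^+ 2)).
  by rewrite ler_piMl ?sqr_ge0//.
have := sqr_ge0 ((X t w - S n t w) + (X s w - S n s w)); nra.
Unshelve. all: by end_near. Qed.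

Lemma elementary_integral_centered (S : seq (@elementary_term R dO Omega d)) T :
  0 <= T -> elementary_wf F D S -> centered P (elementary_integral D W S T).
Proof.
move=> T0; elim: S => [|e S ih] wf.
  rewrite (_ : elementary_integral _ _ _ _ = cst 0); first exact: centered0.
  by apply/funext => w; rewrite /elementary_integral big_nil.
rewrite (_ : elementary_integral _ _ _ _ = ((fun w => \1_(et_event e) w *
    inner D (et_vec e) (W (Num.min (et_stop e) T) w \-
      W (Num.min (et_start e) T) w)) \+ elementary_integral D W S T)); last first.
  by apply/funext => w; rewrite /elementary_integral big_cons.
apply: centeredD; last by apply: ih => i; exact: (wf i.+1).
have [e0 ese FA Lv] := wf 0%N e erefl.
(* If the term starts at or after T, both truncated times are T and the increment is 0. Otherwise
   truncation leaves the start unchanged, and the event belongs to the filtration at that time. *)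
have [Te|eT] := leP T (et_start e).
  rewrite (min_idPr (le_trans Te ese)).
  rewrite (_ : (fun _ => _) = cst 0); first exact: centered0.
  apply/funext => w; rewrite innerC (_ : _ \- _ = fun=> 0) ?inner0l ?mulr0//.
  by apply/funext => x; rewrite /= subrr.
by apply: wiener_increment_centered => //; rewrite le_min ese ltW.
Qed.

Lemma ito_integral_at_centered f T X : 0 <= T ->
  ito_integral_at P F D Q W f T X -> centered P X.
Proof.
move=> T0 [mX [S [wf _ SX]]]; apply: cvg_centered SX => // k.
exact: elementary_integral_centered.
Qed.

End wiener_integral.

(** * Borel sets and volumes of cubes for the iterated product measure *)

Section lebesgue_rV_topology.
Context (R : realType).

Lemma ball_rVE (n : nat) (x : 'rV[R]_n) (e : R) : 0 < e ->
  ball x e = \bigcap_(j in [set: 'I_n])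
    ((fun y : 'rV[R]_n => y ord0 j) @^-1` ball (x ord0 j) e).
Proof.
move=> e0; apply/seteqP; split => y.
  by move=> [_ xy] j _; exact: xy.
by move=> xy; split=> // i j; rewrite (ord1 i); exact: (xy j I).
Qed.

Lemma measurable_ball_rV (n : nat) (x : 'rV[R]_n) (e : R) :
  measurable (ball x e).
Proof.
have [e0|e0] := ltP 0 e; last first.
  rewrite (_ : ball x e = set0) // -subset0 => y [].
  by rewrite ltNge e0.
rewrite ball_rVE//; apply: fin_bigcap_measurable => // j _.
by rewrite -[X in measurable X]setTI; apply: measurable_coor => //;
  exact: measurable_ball.
Qed.

(** The sigma-algebra is generated by the coordinates, so cubes are measurable, and an open set is
    the countable union of the rational cubes that it contains. A rational radius below e/2 keeps a
    cube containing x inside the e-ball around x. *)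
Lemma open_measurable_rV (n : nat) (A : set 'rV[R]_n) : open A -> measurable A.
Proof.
move=> oA.
pose B (q : 'rV[rat]_n * rat) : set 'rV[R]_n :=
  ball (map_mx ratr q.1 : 'rV[R]_n) (ratr q.2).
pose C q := if `[< B q `<=` A >] then B q else set0.
have -> : A = \bigcup_q C q.
  apply/seteqP; split => [x Ax|x [q _]]; last first.
    by rewrite /C; case: asboolP => // BA /BA.
  have /nbhs_ballP[e /= e0 eA] := oA x Ax.
  have [r] := rat_in_itvoo (divr_gt0 e0 (ltr0Sn _ 1)).
  rewrite in_itv/= => /andP[r0 re].
  have /choice[c cE] : forall j : 'I_n, exists q : rat,
      ball (x ord0 j) (ratr r : R) (ratr q).
    move=> j.
    have xr : x ord0 j - ratr r < x ord0 j + ratr r by lra.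
    have [q] := rat_in_itvoo xr.
    rewrite in_itv/= => /andP[xq qx]; exists q.
    by rewrite -ball_normE /= ltr_norml; apply/andP; split; lra.
  exists (\row_j c j, r) => //.
  have Bx : B (\row_j c j, r) x.
    split=> // i j; rewrite (ord1 i) !mxE; exact/ball_sym/cE.
  rewrite /C asboolT// => y By; apply: eA.
  rewrite (splitr e); apply: (@ball_triangle _ _ (map_mx ratr (\row_j c j) : 'rV[R]_n)).
    by apply: (@le_ball _ _ _ (ratr r)); [exact: ltW|exact: ball_sym].
  by apply: (@le_ball _ _ _ (ratr r)); [exact: ltW|exact: By].
apply: countable_bigcupT_measurable => //.
move=> q; rewrite /C; case: asboolP => // _; exact: measurable_ball_rV.
Qed.

(** Sup-norm balls are cubes of side 2e, which split as products along the first coordinate just as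
    the measure does. *)
Lemma lebesgue_rV_ball (n : nat) (x : 'rV[R]_n) (e : R) : 0 < e ->
  lebesgue_rV n (ball x e) = ((e *+ 2) ^+ n)%:E.
Proof.
move=> e0; elim: n x => [|n ih] x.
  by rewrite /= diracE mem_set// ball_rVE// => -[].
rewrite [LHS]/= /lebesgue_rVS /pushforward.
pose x' : 'rV[R]_n := \row_j x ord0 (lift ord0 j).
rewrite (_ : _ @^-1` _ = ball (x ord0 ord0) e `*` ball x' e); last first.
  apply/seteqP; split => -[a v] /=; rewrite !ball_rVE//=.
    move=> xav; split.
      by have := xav ord0 I; rewrite /= mxE unlift_none.
    by move=> j _; have := xav (lift ord0 j) I; rewrite /= !mxE liftK.
  move=> [xa xv] j _ /=; rewrite mxE /=; case: unliftP => [k|] -> //.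
  by have := xv k I; rewrite /= mxE.
rewrite product_measure1E//; last first.
- exact: measurable_ball_rV.
- exact: measurable_ball.
rewrite ih [X in (X * _)%E](_ : _ = (e *+ 2)%:E); first by rewrite -EFinM exprS.
exact: lebesgue_measure_ball (ltW e0).
Qed.

Lemma lebesgue_rV_open_gt0 (n : nat) (A : set 'rV[R]_n) :
  open A -> A !=set0 -> (0 < lebesgue_rV n A)%E.
Proof.
move=> oA [x Ax]; have /nbhs_ballP[e /= e0 eA] := oA x Ax.
apply: (@lt_le_trans _ _ (lebesgue_rV n (ball x e))).
  by rewrite lebesgue_rV_ball// lte_fin exprn_gt0// pmulrn_lgt0.
apply: le_measure eA; rewrite inE; first exact: measurable_ball_rV.
exact: open_measurable_rV.
Qed.

Lemma lebesgue_rV_bounded_lty (n : nat) (A : set 'rV[R]_n) :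
  measurable A -> bounded_set A -> (lebesgue_rV n A < +oo)%E.
Proof.
move=> mA [M [_ /(_ (`|M| + 1))]].
rewrite (le_lt_trans (ler_norm M)) ?ltrDl// => /(_ isT) AM.
have M0 : 0 < `|M| + 2 by rewrite ltr_wpDl.
apply: (@le_lt_trans _ _ (lebesgue_rV n (ball 0 (`|M| + 2)))); last first.
  by rewrite lebesgue_rV_ball// ltry.
apply: le_measure; rewrite ?inE//; first exact: measurable_ball_rV.
move=> x Ax; rewrite -ball_normE /= sub0r normrN.
by rewrite (le_lt_trans (AM x Ax))// ltrD2l ltr1n.
Qed.

End lebesgue_rV_topology.

(** * Traces of positive functions and constant test functions *)

Section boundary_values.
Context (R : realType) (d : nat) (D : set 'rV[R]_d).
Hypothesis domD : smooth_bounded_domain D.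
Local Notation mu := (@lebesgue_rV R d).

Lemma domain_measurable : measurable D.
Proof. by apply: open_measurable_rV; exact: sbd_open domD. Qed.

Lemma domain_volume_lty : (mu D < +oo)%E.
Proof.
exact: lebesgue_rV_bounded_lty domain_measurable (sbd_bounded domD).
Qed.

Lemma domain_volume_gt0 : 0 < fine (mu D).
Proof.
rewrite fine_gt0// domain_volume_lty andbT.
exact: lebesgue_rV_open_gt0 (sbd_open domD) (sbd_nonempty domD).
Qed.

Lemma L2_cst (c : R) : L2 D (fun=> c).
Proof.
split; first exact: measurable_cst.
rewrite (_ : integral _ _ _ = ((c ^+ 2)%:E * mu D)%E).
  apply: lte_mul_pinfty; rewrite ?lee_fin ?sqr_ge0//.
  exact: domain_volume_lty.
by rewrite -(integral_cst _ domain_measurable).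
Qed.

Lemma L2_integrable u : L2 D u -> mu.-integrable D (EFin \o u).
Proof.
move=> Lu; apply: eq_integrable (L2_integrableM domain_measurable Lu (L2_cst 1)).
  exact: domain_measurable.
by move=> x _ /=; rewrite mulr1.
Qed.

(** If g(y) < 0, then |u - g(y)| >= -g(y) almost everywhere in D, so the averages near y cannot tend
    to 0. They are genuine averages: y lies in the closure of D, so D meets each ball in a nonempty
    open set. *)
Lemma boundary_trace_ge0 u g : L2 D u ->
  {ae mu, forall x, D x -> 0 < u x} -> boundary_trace D u g ->
  {ae @surface_measure R d, forall y, boundary D y -> 0 <= g y}.
Proof.
have FF : Filter (almost_everywhere (@surface_measure R d)).
  exact: ae_filter_ringOfSetsType.
move=> Lu u0 [_]; apply: (@filterS _ _ FF) => y + bDy => /(_ bDy) gy.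
rewrite leNgt; apply/negP => gy0.
have average_lt : \forall r \near (0 : R)^'+, (fine (mu (D `&` ball y r)))^-1 *
    \int[mu]_(x in D `&` ball y r) `|u x - g y| < - g y.
  by apply: (cvgr_lt 0 gy); rewrite oppr_gt0.
near (0 : R)^'+ => r.
have avr : (fine (mu (D `&` ball y r)))^-1 *
    \int[mu]_(x in D `&` ball y r) `|u x - g y| < - g y by near: r.
have r0 : 0 < r by near: r; exact: nbhs_right_gt.
pose E := D `&` ball y r.
have oE : open E by apply: openI; [exact: sbd_open domD|exact: ball_open].
have mE : measurable E by exact: open_measurable_rV.
have E0 : E !=set0.
  by case: bDy => + _; apply; exact: nbhsx_ballx.
have Eoo : (mu E < +oo)%E.
  apply: le_lt_trans domain_volume_lty; apply: le_measure => //; rewrite ?inE//.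
    exact: domain_measurable.
  exact: subIsetl.
have fE0 : 0 < fine (mu E).
  by rewrite fine_gt0// Eoo andbT; exact: lebesgue_rV_open_gt0.
have iu : mu.-integrable E (EFin \o u).
  apply: integrableS (L2_integrable Lu) => //; first exact: domain_measurable.
  exact: subIsetl.
have ic c : mu.-integrable E (EFin \o (fun=> c)).
  apply: integrableS (L2_integrable (L2_cst c)) => //.
    exact: domain_measurable.
  exact: subIsetl.
have iug : mu.-integrable E (EFin \o (fun x => `|u x - g y|)).
  apply: integrable_norm => //.
  exact: eq_integrable (integrableB mE iu (ic (g y))).
move: avr; rewrite -/E ltNge => /negP; apply.
rewrite ler_pdivlMl// mulrC -Rintegral_cst// -subr_ge0 -RintegralB//.
apply: Rintegral_ae_ge0; apply: filterS u0 => x u0 [/u0 ux _].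
by rewrite opprK (@gtr0_norm _ (u x - g y)); lra.
Unshelve. all: by end_near. Qed.

Lemma partial_cst (i : 'I_d) (c : R) :
  partial i ((fun=> c) : 'rV[R]_d -> R) = fun=> 0.
Proof. by apply/funext => x; rewrite /partial derive_cst. Qed.

Lemma smooth_cst (c : R) : smooth ((fun=> c) : 'rV[R]_d -> R).
Proof.
move=> k; elim: k c => [|k ih] c /=; first by split; first exact: cst_continuous.
split=> [|i]; first exact: cst_continuous.
split=> [x|]; first exact: derivable_cst.
by rewrite partial_cst; exact: ih.
Qed.

Lemma grad_cst (c : R) x : grad ((fun=> c) : 'rV[R]_d -> R) x = 0.
Proof. by apply/rowP => i; rewrite !mxE partial_cst. Qed.

Lemma laplacian_cst (c : R) : laplacian ((fun=> c) : 'rV[R]_d -> R) = fun=> 0.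
Proof.
by apply/funext => x; rewrite /laplacian big1// => i _; rewrite !partial_cst.
Qed.

End boundary_values.

(** * Measurability in time and chance, and expectations over an event *)

Lemma time_omegaE (R : realType) (dO : measure_display)
    (Omega : measurableType dO) :
  @time_omega R dO Omega = `[0, +oo[%classic `*` setT.
Proof.
by apply/seteqP; split => -[t w]; rewrite /time_omega /= in_itv/= andbT // => -[].
Qed.

Section expectation_bound.
Context (R : realType) (dO : measure_display) (Omega : measurableType dO).
Variable P : probability Omega R.
Local Open Scope ereal_scope.

Lemma expectation_le_centered (f Y : Omega -> R) (v : R) :
  measurable_fun setT f -> (forall w, 0 <= f w)%R -> centered P Y ->
  {ae P, forall w, (f w <= v - Y w)%R} -> \int[P]_w (f w)%:E <= v%:E.
Proof.
move=> mf f0 cY fY; have mY := centered_measurable cY.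
have mvY : measurable_fun setT (fun w => (v - Y w)%R) by exact: measurable_funB.
have iv : P.-integrable setT (EFin \o (fun=> v)).
  exact: finite_measure_integrable_cst.
have -> : v%:E = \int[P]_w (v - Y w)%:E.
  under eq_integral do rewrite EFinB.
  rewrite integralB//; last by case: cY.
  by rewrite cY.2 sube0 integral_cst//= probability_setT mule1.
(* The difference is nonnegative only almost surely; its absolute value is so everywhere, as the
   comparison of integrals requires. *)
rewrite [leRHS](ae_eq_integral (fun w => `|v - Y w|%:E))//.
- apply: ae_ge0_le_integral => //.
  + by move=> w _; rewrite lee_fin.
  + exact/measurable_EFinP.
  + by apply/measurable_EFinP/measurableT_comp.
  + apply: filterS fY => w fw _; rewrite lee_fin (le_trans fw)//.
    exact: ler_norm.
- exact/measurable_EFinP.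
- by apply/measurable_EFinP/measurableT_comp.
- apply: filterS fY => w fw _.
  by rewrite ger0_norm// (le_trans (f0 w)).
Qed.

Lemma predictable_measurable (F : R -> set (set Omega)) :
  complete_filtration P F -> predictable F `<=` measurable.
Proof.
move=> filtF; have mT : measurable (@time_omega R dO Omega).
  by rewrite time_omegaE; exact: measurableX.
apply: smallest_sub.
  split; first exact: measurable0.
  - by move=> A mA; exact: measurableD.
  - by move=> A mA; exact: bigcupT_measurable.
move=> X [[A FA ->]|[s [t [A [s0 st FA ->]]]]].
  by apply: measurableX => //; exact: (filt_measurable filtF (lexx 0%R)).
by apply: measurableX => //; exact: (filt_measurable filtF s0).
Qed.

Variable A : R -> Omega -> R.
Hypothesis mA : measurable_fun (@time_omega R dO Omega) (fun p => A p.1 p.2).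

(** [A] is measurable only for nonnegative times; cutting to [0, T] gives a nonnegative measurable
    function on the whole product, where Tonelli applies. *)
Let B (T : R) (p : R * Omega) : R := (\1_`[0%R, T] p.1 * `|A p.1 p.2|)%R.

Let mB T : measurable_fun setT (B T).
Proof.
have mI : measurable (`[0%R, T]%classic `*` [set: Omega]).
  exact: measurableX.
rewrite (_ : B T = (fun p => `|A p.1 p.2|%R) \_ (`[0%R, T] `*` [set: Omega])).
  apply/(measurable_restrictT _ mI).
  apply: (@measurableT_comp _ _ _ _ _ _ (@Num.norm R R)) => //.
  apply: measurable_funS mA.
    by rewrite time_omegaE; exact: measurableX.
  by move=> [t w] [/=]; rewrite in_itv/= => /andP[] *.
apply/funext => -[t w]; rewrite /B patchE /= indicE.
case: (boolP (t \in _)) => ht.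
  by rewrite mul1r mem_set//; split => //=; exact: set_mem.
rewrite mul0r memNset// => -[/= h _]; move: ht; by rewrite mem_set.
Qed.

Let BE T w : \int[lebesgue_measure]_s (B T (s, w))%:E =
  \int[lebesgue_measure]_(s in `[0%R, T]) `|A s w|%:E.
Proof.
rewrite [RHS]integral_mkcond; apply: eq_integral => s _.
rewrite /B patchE /= indicE; case: (s \in _); by rewrite ?mul1r ?mul0r.
Qed.

Lemma measurable_time_integral (T : R) : measurable_fun setT
  (fun w => \int[lebesgue_measure]_(s in `[0%R, T]) `|A s w|%:E).
Proof.
under eq_fun do rewrite -BE.
apply: (@measurable_fun_fubini_tonelli_G _ _ _ _ R lebesgue_measure
  (fun p => (B T p)%:E)).
  by apply/measurable_EFinP; exact: mB.
by move=> p; rewrite lee_fin mulr_ge0.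
Qed.

Lemma tonelli_event_bound (G : set Omega) (T v : R) : (0 <= T)%R -> measurable G ->
  (forall s, (0 <= s)%R -> (s <= T)%R ->
    \int[P]_w (\1_G w * `|A s w|)%:E <= v%:E) ->
  \int[P]_(w in G) \int[lebesgue_measure]_(s in `[0%R, T]) `|A s w|%:E
    <= (v * T)%:E.
Proof.
move=> T0 mG hA.
pose f (p : R * Omega) := (\1_G p.2 * B T p)%:E.
have mf : measurable_fun setT f.
  apply/measurable_EFinP/measurable_funM; last exact: mB.
  by apply: measurableT_comp => //; exact: measurable_indic.
have f0 p : 0 <= f p by rewrite lee_fin !mulr_ge0.
rewrite [leLHS](_ : _ = \int[P]_w \int[lebesgue_measure]_s f (s, w)); last first.
  rewrite integral_mkcond; apply: eq_integral => w _.
  rewrite patchE /f /= indicE; case: (w \in G).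
    by rewrite -BE; apply: eq_integral => s _; rewrite mul1r.
  by rewrite integral0_eq// => s _; rewrite mul0r.
rewrite -(fubini_tonelli (m1 := lebesgue_measure) (m2 := P))//.
apply: (@le_trans _ _ (\int[lebesgue_measure]_(s in `[0%R, T]) v%:E)).
  rewrite [leRHS]integral_mkcond; apply: le_integral_nonmeasurable => s _.
    exact: integral_ge0.
  rewrite patchE; case: ifPn => [/[!inE]|sT].
    rewrite /= in_itv/= => /andP[s0 sT]; apply: le_trans (hA s s0 sT).
    have sI : (\1_`[0%R, T] s = 1 :> R)%R by rewrite indicE mem_set//= in_itv/= s0.
    by rewrite le_eqVlt; apply/orP; left; apply/eqP/eq_integral => w _;
      rewrite /f /B /= sI mul1r.
  by rewrite integral0_eq// => w _; rewrite /f /B /= [X in (_ * (X * _))%R]indicE (negbTE sT) mul0r mulr0.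
rewrite integral_cst//= lebesgue_measure_itv/= lte_fin.
move: T0; rewrite le_eqVlt => /predU1P[<-|T0].
  by rewrite ltxx mulr0 mule0.
by rewrite T0 oppr0 adde0 EFinM.
Qed.

End expectation_bound.

(** The gap between x^-2 and its tangent at a has an explicit factorization with the double root x =
    a. *)
Lemma inv_sqr_tangent (R : realType) (a x : R) : 0 < a -> 0 < x ->
  3 * a ^- 2 - 2 * a ^- 3 * x <= x ^- 2.
Proof.
move=> a0 x0; rewrite -subr_ge0.
rewrite (_ : _ - _ = (x - a) ^+ 2 * (2 * x + a) / (x ^+ 2 * a ^+ 3)); last first.
  by field; rewrite !gt_eqF.
apply: divr_ge0; apply: mulr_ge0; rewrite ?sqr_ge0 ?exprn_ge0 ?(ltW a0)//.
by rewrite addr_ge0 ?mulr_ge0 ?(ltW a0) ?(ltW x0).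
Qed.

(** * The pathwise inequality for the mass of a weak solution *)

Section weak_solution_mass.
Context (R : realType) (d : nat) (D : set 'rV[R]_d).
Hypothesis domD : smooth_bounded_domain D.
Variables (nu : 'rV[R]_d -> 'rV[R]_d) (beta kappa lambda : R).
Hypotheses (beta_gt0 : 0 < beta) (lambda_gt0 : 0 < lambda).
Context (dO : measure_display) (Omega : measurableType dO).
Variables (P : probability Omega R) (F : R -> set (set Omega)).
Hypothesis filtF : complete_filtration P F.
Variables (Q : ('rV[R]_d -> R) -> 'rV[R]_d -> R).
Variables (W : R -> Omega -> 'rV[R]_d -> R) (xi : Omega -> 'rV[R]_d -> R).
Hypothesis xi_bounds : {ae P, forall w, {ae lebesgue_rV d, forall x, D x ->
  0 < xi w x <= 1}}.
Variables (z : R -> Omega -> 'rV[R]_d -> R) (tau : Omega -> \bar R).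
Hypothesis z_sol : weak_solution P F D Q nu beta kappa lambda W xi z tau.

Let one : 'rV[R]_d -> R := fun=> 1.
Let vol := fine (lebesgue_rV d D).
Let mD := domain_measurable domD.
Let Lone : L2 D one := L2_cst domD 1.

Definition mass t w := inner D (z t w) one.

Lemma mass_measurable :
  measurable_fun (@time_omega R dO Omega) (fun p => mass p.1 p.2).
Proof.
apply: (measurable_inner mD _ _ (ws_predictable z_sol) Lone).
  by rewrite time_omegaE; exact: measurableX.
exact: predictable_measurable filtF.
Qed.

Let zL2 t w : 0 <= t -> L2 D (z t w).
Proof. by move=> t0; have [+ _] := ws_predictable z_sol; move/(_ (t, w) t0). Qed.

Let vol_inner : vol = inner D one one.
Proof.
by rewrite /inner /one (Rintegral_cst _ mD) mul1r mul1r.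
Qed.

Lemma initial_mass_le w : {ae lebesgue_rV d, forall x, D x -> z 0 w x <= 1} ->
  mass 0 w <= vol.
Proof.
move=> z1; rewrite -subr_ge0 vol_inner -innerBl//; last exact: zL2.
apply: Rintegral_ae_ge0; apply: filterS z1 => x z1 /z1.
by rewrite /one mulr1 subr_ge0.
Qed.

Lemma mass_ge0 t w : {ae lebesgue_rV d, forall x, D x -> 0 < z t w x} ->
  0 <= mass t w.
Proof.
move=> z0; apply: Rintegral_ae_ge0; apply: filterS z0 => x z0 /z0.
by rewrite /one mulr1 => /ltW.
Qed.

(** The tangent inequality integrated over D. Integrability of z^-2 matters: a divergent integral
    would be read as 0 by [inner]. *)
Lemma reaction_ge (a : R) t w : 0 < a -> 0 <= t ->
  {ae lebesgue_rV d, forall x, D x -> 0 < z t w x} ->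
  (lebesgue_rV d).-integrable D (fun x => ((z t w x) ^- 2 * one x)%:E) ->
  3 * a ^- 2 * vol <=
    inner D (fun x => (z t w x) ^- 2) one + 2 * a ^- 3 * mass t w.
Proof.
move=> a0 t0 z0 iz.
have Lz := zL2 w t0.
rewrite vol_inner -innerZl// -[2 * _ * _]innerZl// -subr_ge0.
rewrite /inner -RintegralD//; last exact: L2_integrableM (L2Z _ _ Lz) Lone.
rewrite -RintegralB//; last 2 first.
- exact: integrableD iz (L2_integrableM mD (L2Z mD _ Lz) Lone).
- exact: L2_integrableM (L2Z mD _ Lone) Lone.
apply: Rintegral_ae_ge0; apply: filterS z0 => x z0 /z0 zx.
by have := inv_sqr_tangent a0 zx; rewrite /one !mulr1; lra.
Qed.

Lemma mass_time_measurable (t : R) w :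
  measurable_fun `[0, t] (fun s => mass s w).
Proof.
apply: (@measurable_comp _ _ _ _ _ _ (@time_omega R dO Omega)
  (fun p => mass p.1 p.2) _ (fun s => (s, w))).
- by rewrite time_omegaE; exact: measurableX.
- by move=> _ [s /= + <-]; rewrite /time_omega /= in_itv/= => /andP[].
- exact: mass_measurable.
- by apply: measurable_funTS; apply: measurable_fun_pair.
Qed.

(* Test function 1: the diffusion term vanishes, the boundary flux has a sign,
   and the reaction is bounded below by the tangent of x^-2 at [a]. *)
Lemma mass_estimate : exists I,
  ito_integral P F D Q W tau (fun s w => mul_test (z s w) one) I /\
  {ae P, forall w, forall t, 0 <= t -> (t%:E < tau w)%E ->
    [/\ 0 <= mass t w, mass t w <= vol - kappa * I t w &
      forall a, 0 < a -> ((3 * a ^- 2 * vol * t)%:E <=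
        (lambda^-1 * (vol - kappa * I t w))%:E +
        (2 * a ^- 3)%:E *
          \int[lebesgue_measure]_(s in `[0%R, t]) `|mass s w|%:E)%E]}.
Proof.
have one_smooth : smooth one by exact: smooth_cst.
have [zb [trace /(_ one one_smooth) [I [itoI eqI]]]] := ws_equation z_sol.
exists I; split => //.
have := xi_bounds; have := ws_initial z_sol; have := ws_positive z_sol.
move=> pos0 init0 xi1.
apply: filterS2 (filterI trace eqI) (filterI pos0 (filterI init0 xi1)).
move=> w [{}trace {}eqI] [z0 [zxi {}xi1]] t t0 tt.
have [iz ifl idf irc eqA] := eqI t t0 tt.
have s_tau s : `[0, t]%classic s -> 0 <= s /\ (s%:E < tau w)%E.
  rewrite /= in_itv/= => /andP[s0 st]; split => //.
  by apply: le_lt_trans tt; rewrite lee_fin.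
have mass0 : mass 0 w <= vol.
  apply: initial_mass_le; move: zxi xi1; apply: filterS2 => x zx xx Dx.
  by rewrite zx//; have /andP[] := xx Dx.
have FL : Filter (almost_everywhere (@lebesgue_measure R)).
  exact: ae_filter_ringOfSetsType.
have flux_le0 : \int[lebesgue_measure]_(s in `[0, t])
    \int[@surface_measure R d]_(y in boundary D)
      (- beta * zb s w y * one y - zb s w y * dotv (grad one y) (nu y)) <= 0.
  apply: Rintegral_ae_le0; move: trace; apply: (@filterS _ _ FL) => s traces /s_tau[s0 st].
  apply: Rintegral_ae_le0.
  have := boundary_trace_ge0 domD (zL2 w s0) (z0 s s0 st) (traces s0 st).
  apply: (@filterS _ _ (ae_filter_ringOfSetsType _)) => y zb0 /zb0 zby.
  rewrite grad_cst (_ : dotv _ _ = 0).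
    by rewrite mulr0 subr0 /one mulr1 mulNr oppr_le0 mulr_ge0// ltW.
  by rewrite /dotv big1// => i _; rewrite mxE mul0r.
have diff0 : \int[lebesgue_measure]_(s in `[0, t])
    inner D (z s w) (laplacian one) = 0.
  rewrite /Rintegral integral0_eq// => s _.
  by rewrite laplacian_cst innerC inner0l.
have reaction0 : 0 <= \int[lebesgue_measure]_(s in `[0, t])
    inner D (fun x => (z s w x) ^- 2) one.
  apply: Rintegral_ge0 => s _; apply: Rintegral_ge0 => x _.
  by rewrite /one mulr1 invr_ge0 sqr_ge0.
have massA := mass_ge0 (z0 t t0 tt).
have mass_eq : mass t w <= vol - kappa * I t w - lambda *
    \int[lebesgue_measure]_(s in `[0, t]) inner D (fun x => (z s w x) ^- 2) one.
  move: eqA flux_le0 mass0 diff0.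
  rewrite -/(mass t w) -/(mass 0 w) => -> /=.
  set f := Rintegral _ _ _; set g := Rintegral _ _ _.
  set h := Rintegral _ _ _.
  lra.
split => //.
  by apply: le_trans mass_eq _; rewrite gerBl mulr_ge0// ltW.
move=> a a0.
set rc := (X in Rintegral _ _ X) in mass_eq reaction0.
have irc' : lebesgue_measure.-integrable `[0, t] (EFin \o rc) by exact: irc.
have a2 : 0 <= 2 * a ^- 3 by rewrite mulr_ge0// invr_ge0 exprn_ge0// ltW.
have mm : measurable_fun `[0, t]%classic (fun s => `|mass s w|%:E).
  apply/measurable_EFinP; apply: (@measurableT_comp _ _ _ _ _ _ (@Num.norm R R)) => //.
  exact: mass_time_measurable.
(* The nonnegative mass at time t is dropped from [mass_eq], and the rest is divided by lambda. *)
have rc_le : (\int[lebesgue_measure]_(s in `[0%R, t]) (rc s)%:E <=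
    (lambda^-1 * (vol - kappa * I t w))%:E)%E.
  rewrite -(fineK (integrable_fin_num _ irc'))// lee_fin.
  rewrite ler_pdivlMl//; move: mass_eq; rewrite /Rintegral /=; lra.
apply: le_trans (leeD2r _ rc_le).
rewrite -ge0_integralZl//.
rewrite -ge0_integralD//; last 4 first.
- move=> s _; rewrite lee_fin; apply: Rintegral_ge0 => x _.
  by rewrite /one mulr1 invr_ge0 sqr_ge0.
- exact: measurable_int irc'.
- by move=> s _; rewrite -EFinM lee_fin mulr_ge0.
- exact: measurable_funeM.
apply: (@le_trans _ _ (\int[lebesgue_measure]_(s in `[0%R, t])
    (3 * a ^- 2 * vol)%:E)%E).
  rewrite integral_cst//= lebesgue_measure_itv/= lte_fin.
  move: t0; rewrite le_eqVlt => /predU1P[<-|t0]; first by rewrite ltxx mulr0 mule0.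
  by rewrite t0 oppr0 adde0 EFinM.
apply: ae_ge0_le_integral => //.
- move=> s _; rewrite lee_fin !mulr_ge0// ?invr_ge0 ?exprn_ge0 ?fine_ge0//.
  exact: ltW.
- move=> s _; rewrite -EFinM -EFinD lee_fin addr_ge0 ?(mulr_ge0 a2)//.
  by apply: Rintegral_ge0 => x _; rewrite /one mulr1 invr_ge0 sqr_ge0.
- apply: emeasurable_funD; first exact: measurable_int irc'.
  exact: measurable_funeM.
- move: iz; apply: (@filterS _ _ FL) => s izs st.
  have [s0 stau] := s_tau s st.
  move: st; rewrite /= in_itv/= => /andP[_ st].
  rewrite -EFinM -EFinD lee_fin ger0_norm; last exact: mass_ge0 (z0 s s0 stau).
  exact: reaction_ge (z0 s s0 stau) (izs s0 st).
Qed.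

End weak_solution_mass.

(** * From the pathwise inequality to the probability of survival *)

Section survival.
Context (R : realType) (dO : measure_display) (Omega : measurableType dO).
Variable P : probability Omega R.

(** The last hypothesis is integrated over [G]. Since v - X_T is almost surely nonnegative, its
    integral over [G] is at most its full mean v; the time integral is at most v T, by Tonelli and
    the same argument at each s. *)
Lemma event_probability_bound (A : R -> Omega -> R) (G : set Omega)
    (T v c e l : R) (X : R -> Omega -> R) :
  measurable_fun (@time_omega R dO Omega) (fun p => A p.1 p.2) ->
  measurable G -> 0 <= T -> 0 <= v -> 0 <= c -> 0 <= e -> 0 <= l ->
  (forall s, 0 <= s -> s <= T -> centered P (X s)) ->
  (forall s, 0 <= s -> s <= T ->
    {ae P, forall w, \1_G w * `|A s w| <= v - X s w}) ->
  {ae P, forall w, G w -> (c%:E <= (l * (v - X T w))%:E +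
    e%:E * \int[lebesgue_measure]_(s in `[0%R, T]) `|A s w|%:E)%E} ->
  (c%:E * P G <= (l * v)%:E + e%:E * (v * T)%:E)%E.
Proof.
move=> mA mG T0 v0 c0 e0 l0 cX AX hG.
have XT0 : {ae P, forall w, 0 <= v - X T w}.
  apply: filterS (AX T T0 (lexx _)) => w; apply: le_trans.
  by rewrite mulr_ge0.
have mX := centered_measurable (cX T T0 (lexx _)).
have mvX : measurable_fun setT (fun w => `|l * (v - X T w)|).
  apply: (@measurableT_comp _ _ _ _ _ _ (@Num.norm R R)) => //.
  by apply: measurable_funM => //; exact: measurable_funB.
pose H w := (\int[lebesgue_measure]_(s in `[0%R, T]) `|A s w|%:E)%E.
have mH : measurable_fun setT H by exact: measurable_time_integral.
have H0 w : (0 <= H w)%E by apply: integral_ge0.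
apply: (@le_trans _ _ (\int[P]_(w in G) (`|l * (v - X T w)|%:E + e%:E * H w))%E).
  rewrite -integral_cst//; apply: ae_ge0_le_integral => //.
  - by move=> w _; rewrite adde_ge0 ?mule_ge0.
  - apply: measurable_funTS; apply: emeasurable_funD.
      exact/measurable_EFinP.
    exact: measurable_funeM.
  - apply: filterS hG => w hG Gw; apply: le_trans (hG Gw) _.
    by rewrite leeD2r// lee_fin ler_norm.
rewrite ge0_integralD//; last 3 first.
- by apply/measurable_EFinP; exact: measurable_funTS.
- by move=> w _; rewrite mule_ge0.
- by apply: measurable_funTS; exact: measurable_funeM.
rewrite ge0_integralZl//; last exact: measurable_funTS.
apply: leeD; last first.
  apply: lee_wpmul2l; first by rewrite lee_fin.
  apply: tonelli_event_bound => // s s0 sT.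
  apply: (expectation_le_centered _ _ (cX s s0 sT)) => //; last exact: AX.
  - apply: measurable_funM; first exact: measurable_indic.
    apply: (@measurableT_comp _ _ _ _ _ _ (@Num.norm R R)) => //.
    apply: (@measurable_comp _ _ _ _ _ _ (@time_omega R dO Omega)
      (fun p => A p.1 p.2) setT (fun w => (s, w))) => //.
    + by rewrite time_omegaE; exact: measurableX.
    + by move=> _ [w _ <-].
    + exact: measurable_fun_pair.
rewrite integral_mkcond (eq_integral (fun w => (\1_G w * `|l * (v - X T w)|)%:E)).
  apply: (expectation_le_centered _ _ (centeredZ l (cX T T0 (lexx _)))).
  - by apply: measurable_funM => //; exact: measurable_indic.
  - by move=> w /=; exact: mulr_ge0.
  - apply: filterS XT0 => w X0.
    rewrite -mulrBr ger0_norm; last exact: mulr_ge0.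
    by rewrite ler_piMl ?mulr_ge0// indicE lern1; case: (_ \in _).
move=> w _; rewrite patchE indicE; case: (_ \in _); by rewrite ?mul1r ?mul0r.
Qed.

Lemma le_probability_ae (A B : set Omega) : measurable A -> measurable B ->
  {ae P, forall w, A w -> B w} -> (P A <= P B)%E.
Proof.
move=> mA mB [N [mN N0 AB]].
have AN : A `<=` B `|` N.
  move=> w Aw; have [Bw|nBw] := pselect (B w); [by left|right].
  by apply: AB => /= /(_ Aw).
apply: le_trans (le_measure _ _ _ AN) _; rewrite ?inE//.
  exact: measurableU.
apply: le_trans (measureU2 _ _ _) _ => //.
by rewrite [X in (_ + X)%E](_ : _ = 0%E) ?adde0.
Qed.

(** Almost surely on [A], the inequality T < rho n holds from some index on, and continuity from
    below finds one index. *)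
Lemma exists_event_gt (A : set Omega) (rho : nat -> Omega -> R) (T q : R) :
  measurable A -> (forall n, measurable [set w | T < rho n w]) ->
  {ae P, forall w, A w -> (fun n => (rho n w)%:E) @ \oo --> +oo%E} ->
  (q%:E < P A)%E -> exists n, (q%:E <= P [set w | (T < rho n w)%R])%E.
Proof.
move=> mA mG rhoA qA.
(* Tail intersections increase at every outcome, whatever the order of the [rho n]. *)
pose H n := \bigcap_(m >= n) [set w | T < rho m w].
have mH n : measurable (H n) by apply: bigcap_measurable => //; exists n => /=.
have mUH : measurable (\bigcup_n H n) by exact: bigcupT_measurable.
have PA : (P A <= P (\bigcup_n H n))%E.
  apply: le_probability_ae => //; apply: filterS rhoA => w rhoA /rhoA rhow.
  have [n _ nT] := rhow _ (open_ereal_gt' (ltry T)).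
  by exists n => // m /= nm; have := nT m nm; rewrite /= lte_fin.
have cvH := nondecreasing_cvg_mu (mu := P) mH mUH.
have ndH : {homo H : n m / (n <= m)%N >-> (n <= m)%O}.
  move=> n m nm; apply/subsetPset => w Hn k /= mk; apply: Hn => /=.
  exact: leq_trans mk.
have [n _ /(_ n (leqnn n)) /= qn] :=
  cvH ndH _ (open_ereal_gt' (lt_le_trans qA PA)).
exists n; apply: le_trans (ltW qn) _; apply: le_measure; rewrite ?inE//.
by move=> w; apply => /=.
Qed.

End survival.

Theorem theorem5p1 (R : realType) (d : nat) (d13 : (1 <= d <= 3)%N)
  (D : set 'rV[R]_d) (D_domain : smooth_bounded_domain D)
  (nu : 'rV[R]_d -> 'rV[R]_d) (nu_normal : outward_unit_normal D nu)
  (beta kappa lambda : R)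
  (beta_gt0 : 0 < beta) (kappa_gt0 : 0 < kappa) (lambda_gt0 : 0 < lambda)
  (dO : measure_display) (Omega : measurableType dO) (P : probability Omega R)
  (F : R -> set (set Omega)) (F_filtration : complete_filtration P F)
  (Q : ('rV[R]_d -> R) -> 'rV[R]_d -> R)
  (chi : nat -> 'rV[R]_d -> R) (gamma : nat -> R)
  (Q_cov : covariance_operator D Q chi gamma)
  (b : nat -> R -> Omega -> R) (W : R -> Omega -> 'rV[R]_d -> R)
  (W_wiener : Q_wiener P F D chi gamma b W)
  (xi : Omega -> 'rV[R]_d -> R)
  (xi_bounds : {ae P, forall w, {ae lebesgue_rV d, forall x, D x ->
                 0 < xi w x <= 1}})
  (z : R -> Omega -> 'rV[R]_d -> R) (tau : Omega -> \bar R)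
  (z_solution : weak_solution P F D Q nu beta kappa lambda W xi z tau)
  (tau_quenching : quenching_time P D z tau) :
  quenches_in_finite_time_as P tau.
Proof.
have mD := domain_measurable D_domain.
pose vol := fine (lebesgue_rV d D).
have vol_gt0 : 0 < vol by exact: domain_volume_gt0.
pose A := mass D z.
have mA := mass_measurable D_domain F_filtration z_solution.
have [I [[_ [rho [[rho_stop rho_tau] itoI]]] estimate]] :=
  mass_estimate D_domain beta_gt0 lambda_gt0 F_filtration xi_bounds z_solution.
have rho_ge0 n w : 0 <= rho n w by have := (rho_stop n).1 w; rewrite lee_fin.
have mG n T : 0 <= T -> measurable [set w | T < rho n w].
  move=> T0.
  rewrite (_ : [set _ | _] = ~` [set w | ((rho n w)%:E <= T%:E)%E]).
    apply: measurableC; apply: (filt_measurable F_filtration T0).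
    exact: (rho_stop n).2.
  by apply/seteqP; split => w /=; rewrite lee_fin ltNge => /negP.
have mtau : measurable [set w | (tau w < +oo)%E].
  rewrite (_ : [set _ | _] = \bigcup_n [set w | (tau w <= n%:R%:E)%E]).
    apply: bigcupT_measurable => n.
    by apply: (filt_measurable F_filtration (ler0n _ n));
      exact: (ws_lifetime z_solution).2.
  apply/seteqP; split => w /=; last first.
    by move=> [n _ /= tn]; apply: le_lt_trans tn _; rewrite ltry.
  have := (ws_lifetime z_solution).1 w.
  case E : (tau w) => [r|//|//] _ _; exists (Num.bound `|r|) => //=.
  rewrite E lee_fin ltW//; apply: le_lt_trans (ler_norm r) _.
  exact: archi_boundP (normr_ge0 r).
have bound n T a : 0 < T -> 0 < a ->
    ((3 * a ^- 2 * vol * T)%:E * P [set w | (T < rho n w)%R] <=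
      (lambda^-1 * vol)%:E + (2 * a ^- 3)%:E * (vol * T)%:E)%E.
  move=> T0 a0.
  have stopped s w : 0 <= s -> 0 <= Num.min s (rho n w).
    by move=> s0; rewrite le_min s0 rho_ge0.
  apply: (@event_probability_bound _ _ _ P A _ T vol _ _ _
    (fun s w => kappa * I (Num.min s (rho n w)) w)) => //.
  - by apply: mG; exact: ltW.
  - exact: ltW.
  - exact: ltW.
  - by rewrite !mulr_ge0 ?invr_ge0 ?exprn_ge0 ?ltW.
  - by rewrite !mulr_ge0 ?invr_ge0 ?exprn_ge0 ?ltW.
  - by rewrite invr_ge0 ltW.
  - move=> s s0 _; apply: centeredZ.
    have [_ /(ito_integral_at_centered F_filtration mD Q_cov W_wiener s0)] :=
      itoI n s s0.
    exact.
  - move=> s s0 sT; move: rho_tau estimate; apply: filterS2.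
    move=> w [_ rho_lt _] est.
    have [|m0 mv _] := est _ (stopped s w s0).
      by apply: le_lt_trans (rho_lt n); rewrite lee_fin ge_min lexx orbT.
    (* On the event the stopped time is s itself. Off it the left side is 0, and the estimate at the
       stopped time, still below [tau], makes the right side nonnegative. *)
    have [wG|wG] := pselect (T < rho n w).
      rewrite indicE mem_set// mul1r; move: m0 mv.
      rewrite min_l; last by rewrite ltW// (le_lt_trans sT).
      by move=> m0 mv; rewrite ger0_norm.
    by rewrite indicE memNset// mul0r; apply: le_trans mv.
  - move: rho_tau estimate; apply: filterS2 => w [_ rho_lt _] est /= Tw.
    have [|_ _ /(_ a a0)] := est T (ltW T0).
      by apply: lt_trans (rho_lt n); rewrite lte_fin.
    by rewrite min_l //; exact: ltW.
rewrite /quenches_in_finite_time_as.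
pose S := ~` [set w | (tau w < +oo)%E].
have mS : measurable S by exact: measurableC.
suff PS0 : P S = 0%E.
  have := probability_setC P mS; rewrite setCK PS0 => ->.
  by rewrite sube0.
apply/eqP; rewrite eq_le measure_ge0 andbT leNgt; apply/negP => PS_gt0.
have PSfin : P S \is a fin_num by exact: fin_num_measure.
(* Halving leaves q strictly below P(S), as the choice of n demands. *)
pose q := fine (P S) / 2.
have q_gt0 : 0 < q.
  by rewrite divr_gt0// fine_gt0// PS_gt0 -ge0_fin_numE.
have qS : (q%:E < P S)%E.
  by rewrite -(fineK PSfin) lte_fin /q; have := q_gt0; rewrite /q; lra.
(* With a = 2/q this gives q^3 T / 4 = 1 / lambda: the left side becomes 3 |D| / lambda and each
   term on the right |D| / lambda, so 3 <= 2. *)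
pose T := 4 / (lambda * q ^+ 3).
have T_gt0 : 0 < T by rewrite divr_gt0// mulr_gt0// exprn_gt0.
have [|n qG] := exists_event_gt (rho := rho) mS (fun n => mG n T (ltW T_gt0)) _ qS.
  apply: filterS rho_tau => w [_ _ rho_cvg] /negP.
  by rewrite -leNgt leye_eq => /eqP <-.
pose a := 2 / q.
have a_gt0 : 0 < a by rewrite divr_gt0.
have : ((3 * a ^- 2 * vol * T)%:E * q%:E <=
    (lambda^-1 * vol)%:E + (2 * a ^- 3)%:E * (vol * T)%:E)%E.
  apply: le_trans (bound n T a T_gt0 a_gt0).
  apply: lee_wpmul2l => //.
  rewrite lee_fin (mulr_ge0 _ (ltW T_gt0))// (mulr_ge0 _ (ltW vol_gt0))//.
  by rewrite mulr_ge0// invr_ge0 exprn_ge0// ltW.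
rewrite -!EFinM -EFinD lee_fin.
have -> : 3 * a ^- 2 * vol * T * q = 3 * (lambda^-1 * vol).
  by rewrite /a /T; field; rewrite !gt_eqF.
have -> : 2 * a ^- 3 * (vol * T) = lambda^-1 * vol.
  by rewrite /a /T; field; rewrite !gt_eqF.
have : 0 < lambda^-1 * vol by rewrite mulr_gt0 ?invr_gt0.
lra.
Qed.
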